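(* Let $n\ge 3$ be an integer, $r>0$, and let $F$ be the chord length distribution function of $\mathcal P_{n,r}$. Then $F(s)=0$ for $s\le 0$, $F(s)=1$ for $s\ge \ell_{K+1}$, and for every $k\in\{0,\dots,K\}$ and every $s$ with $\ell_k\le s<\ell_{k+1}$ and $s>0$ we have $F(s)=H_k(s)$, where $H_k(s)$ is given as follows. (i) If $n$ is even and $k\in\{0,\dots,K-1\}$, or if $n$ is odd and $s<\lambda$: $$H_k(s)=1-h_k\big(s,A_1(k),B_1(k)\big)+h_{k+1}\big(s,A_1(k),B_1(k)+\tfrac{\pi}{n}\big).$$ (ii) If $n$ is odd and $s\ge\lambda$ (which forces $k=K$): $$H_K(s)=1-h_K\big(s,A_1(K),B_1(K)\big)+h_{K+1}\big(s,A_1(K),B_1(K)+\tfrac{\pi}{n}\big)-h_{K+1}\big(s,A_2,B_2+\tfrac{\pi}{n}\big)-h_{K+1}\big(s,A_2,B_2\big).$$ (iii) If $n$ is even and $k=K$: $$H_K(s)=1-h_K\big(s,A_1(K),B_1(K)\big).$$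
   Context: Let $n\ge 3$ be an integer and $r>0$. $\mathcal P_{n,r}$ denotes the regular polygon with $n$ sides whose circumscribed circle has radius $r$ and centre at the origin $O$. Its perimeter is $u=2nr\sin(\pi/n)$. A line in the plane is written $g(p,\phi)=\{(x,y)\in\mathbb R^2: x\cos\phi+y\sin\phi=p\}$ with $p\ge 0$, $0\le\phi<2\pi$; the measure $\mu$ of a set of lines is the integral of $dp\,d\phi$ over the set (the motion-invariant line measure). For a line $g$ meeting $\mathcal P_{n,r}$, $\chi(g)=g\cap\mathcal P_{n,r}$ is its chord and $|\chi(g)|$ its length. The chord length distribution function is $F(s)=\frac1u\,\mu(\{g: g\cap\mathcal P_{n,r}\neq\emptyset,\ |\chi(g)|\le s\})$ (the measure of all lines meeting $\mathcal P_{n,r}$ equals $u$). Notation: $K=\lfloor (n-2)/2\rfloor$; $\ell_k=2r\sin(k\pi/n)$ for $k=0,\dots,K+1$; $\lambda=2r\cos^2\frac{\pi}{2n}$; $A_1(k)=2r\sin\frac{k\pi}{n}\sin\frac{(k+1)\pi}{n}$, $B_1(k)=\frac{k\pi}{n}$; $A_2=2r\cos^2\frac{\pi}{2n}$, $B_2=\frac{\pi}{2}\big(1-\frac1n\big)$. For integers $k\ge1$ (only values with $\sin(2k\pi/n)\ne0$ and $\cos(k\pi/n)\neq 0$ occur) and reals $a,b$: $\Theta_1(k,a,b)=\frac{1}{4r}\csc\frac{\pi}{n}\big(\sin(2b)\csc\frac{2k\pi}{n}-2b\cot\frac{2k\pi}{n}\big)$, $\Theta_2(k,a,b)=a\big(\cos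 b\cot\frac{\pi}{n}\sec\frac{k\pi}{n}-\frac{a}{2r}\sin(2b)\csc\frac{\pi}{n}\csc\frac{2k\pi}{n}\big)$, $\Theta_3(k,a,b)=-\big(\sin b\cot\frac{\pi}{n}\sec\frac{k\pi}{n}+\frac{a}{2r}\cos(2b)\csc\frac{\pi}{n}\csc\frac{2k\pi}{n}\big)$, $\Theta_4(k,a,b)=\frac{1}{2r}\csc\frac{\pi}{n}\cot\frac{2k\pi}{n}$. For $s>0$ with $s\ge a\ge0$: $L_1(s,a)=s$, $L_2(s,a)=1/s$, $L_3(s,a)=\sqrt{s^2-a^2}/s$, $L_4(s,a)=s\arcsin(a/s)$, and $h_k(s,a,b)=0$ if $k=0$, $h_k(s,a,b)=\sum_{i=1}^4\Theta_i(k,a,b)L_i(s,a)$ if $k\ge1$. *)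

(* Defs.v *)
From Stdlib Require Import Reals Lra Lia Arith ClassicalEpsilon.
Open Scope R_scope.

(* The regular n-gon P_{n,r}: circumradius r, centre O, vertices at the angles
   2*pi*j/n (j = 0..n-1).  It is the intersection of the n half-planes whose
   outer normals point at the angles (2j+1)*pi/n, at distance r*cos(pi/n). *)
Definition in_polygon (n : nat) (r x y : R) : Prop :=
  forall j : nat, (j < n)%nat ->
    x * cos (INR (2 * j + 1) * PI / INR n) + y * sin (INR (2 * j + 1) * PI / INR n)
      <= r * cos (PI / INR n).

(* The line g(p,phi) = {(x,y) | x cos phi + y sin phi = p} parametrised by
   t |-> (p cos phi - t sin phi, p sin phi + t cos phi) (unit speed).
   chord_param n r p phi t  <->  the point of parameter t lies in the chord. *)
Definition chord_param (n : nat) (r p phi t : R) : Prop :=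
  in_polygon n r (p * cos phi - t * sin phi) (p * sin phi + t * cos phi).

Definition meets (n : nat) (r p phi : R) : Prop := exists t, chord_param n r p phi t.

(* |chi(g)| <= s : the chord (a segment) has length (= diameter) at most s. *)
Definition chord_le (n : nat) (r p phi s : R) : Prop :=
  forall t1 t2, chord_param n r p phi t1 -> chord_param n r p phi t2 -> Rabs (t1 - t2) <= s.

Definition ind (n : nat) (r s phi p : R) : R :=
  if excluded_middle_informative (meets n r p phi /\ chord_le n r p phi s) then 1 else 0.

Definition is_RInt (f : R -> R) (a b I : R) : Prop :=
  exists pr : Riemann_integrable f a b, RiemannInt pr = I.

Definition perim (n : nat) (r : R) : R := 2 * INR n * r * sin (PI / INR n).

(* chord_cdf n r s v  <->  F(s) = v, where
   F(s) = (1/u) * mu{g : g meets P, |chi(g)| <= s}, the measure being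
   int_0^{2pi} int_0^{infty} 1[...] dp dphi.  Lines with p > r miss the
   circumscribed disc, hence P, so the p-integral is taken over [0, r]. *)
Definition chord_cdf (n : nat) (r s v : R) : Prop :=
  exists G : R -> R,
    (forall phi, 0 <= phi <= 2 * PI -> is_RInt (ind n r s phi) 0 r (G phi)) /\
    is_RInt G 0 (2 * PI) (perim n r * v).

Definition Kn (n : nat) : nat := ((n - 2) / 2)%nat.
Definition ell (n : nat) (r : R) (k : nat) : R := 2 * r * sin (INR k * PI / INR n).
Definition lam (n : nat) (r : R) : R := 2 * r * (cos (PI / (2 * INR n)))^2.
Definition A1 (n : nat) (r : R) (k : nat) : R :=
  2 * r * sin (INR k * PI / INR n) * sin (INR (k + 1) * PI / INR n).
Definition B1 (n : nat) (k : nat) : R := INR k * PI / INR n.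
Definition A2 (n : nat) (r : R) : R := 2 * r * (cos (PI / (2 * INR n)))^2.
Definition B2 (n : nat) : R := PI / 2 * (1 - 1 / INR n).

Definition csc (x : R) : R := 1 / sin x.
Definition sec (x : R) : R := 1 / cos x.
Definition cot (x : R) : R := cos x / sin x.

Definition Theta1 (n : nat) (r : R) (k : nat) (a b : R) : R :=
  1 / (4 * r) * csc (PI / INR n) *
  (sin (2 * b) * csc (2 * INR k * PI / INR n) - 2 * b * cot (2 * INR k * PI / INR n)).
Definition Theta2 (n : nat) (r : R) (k : nat) (a b : R) : R :=
  a * (cos b * cot (PI / INR n) * sec (INR k * PI / INR n)
       - a / (2 * r) * sin (2 * b) * csc (PI / INR n) * csc (2 * INR k * PI / INR n)).
Definition Theta3 (n : nat) (r : R) (k : nat) (a b : R) : R :=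
  - (sin b * cot (PI / INR n) * sec (INR k * PI / INR n)
     + a / (2 * r) * cos (2 * b) * csc (PI / INR n) * csc (2 * INR k * PI / INR n)).
Definition Theta4 (n : nat) (r : R) (k : nat) (a b : R) : R :=
  1 / (2 * r) * csc (PI / INR n) * cot (2 * INR k * PI / INR n).

Definition L1 (s a : R) : R := s.
Definition L2 (s a : R) : R := 1 / s.
Definition L3 (s a : R) : R := sqrt (s ^ 2 - a ^ 2) / s.
Definition L4 (s a : R) : R := s * asin (a / s).

Definition hk (n : nat) (r : R) (k : nat) (s a b : R) : R :=
  match k with
  | O => 0
  | _ => Theta1 n r k a b * L1 s a + Theta2 n r k a b * L2 s a
         + Theta3 n r k a b * L3 s a + Theta4 n r k a b * L4 s a
  end.

Definition Hk (n : nat) (r : R) (k : nat) (s : R) : R :=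
  let K := Kn n in
  let case_i := 1 - hk n r k s (A1 n r k) (B1 n k)
                  + hk n r (k + 1) s (A1 n r k) (B1 n k + PI / INR n) in
  if Nat.even n then
    (if (k <? K)%nat then case_i
     else 1 - hk n r K s (A1 n r K) (B1 n K))
  else
    (if Rlt_dec s (lam n r) then case_i
     else 1 - hk n r K s (A1 n r K) (B1 n K)
            + hk n r (K + 1) s (A1 n r K) (B1 n K + PI / INR n)
            - hk n r (K + 1) s (A2 n r) (B2 n + PI / INR n)
            - hk n r (K + 1) s (A2 n r) (B2 n)).

(* Main.v *)
(** Fix a direction [phi] of the normal and write [a = PI/n].  The chord length is a concave
    function of [p], so the lines with a chord longer than [s] form an interval of values of [p],
    whose upper end is the level at which two edge lines cut a segment of length [s] out of the
    line.  If [ell k <= s <= ell (k+1)], these two edges are [k] or [k+1] apart, according to the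
    angle between [phi] and the bisector of the edges; for the critical angle the chord starts
    at a vertex.  By the dihedral symmetry it suffices to integrate the level over [[0, a]].
    It is the trigonometric polynomial [level], and [hk k s A b] is, up to the factor [r sin a],
    its antiderivative taken at [asin (A/s) - b].  When no chord of the direction is longer than
    [s], the level is replaced by [0]; this happens only for the last [k]. *)

From Coquelicot Require Import Coquelicot.
From Stdlib Require Import Reals Lra Lia ZArith ClassicalEpsilon FunctionalExtensionality.
Require Import Defs.
Open Scope R_scope.

(** * Chords of the polygon *)

(** Only [0 <= p <= r] is integrated, while the interval of lines with long chords may lie anywhere
    about [0]: for odd [n] its upper end can be negative. Its lower end is minus the upper end for
    the antipodal direction. So, with [B] the upper end, a direction loses the positive part of [B]
    minus the negative part of [B] at its antipode. The antipode acts on the sector as the identity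
    or as a reflection; after integration both parts recombine into the integral of the signed [B],
    whose sign never has to be studied. The chord itself is never computed. An upper bound for [p]
    needs only the inequalities of two edges, and attainment needs only that both endpoints lie on
    these edges. Inside the interval the indicator must vanish, so the chords there must be strictly
    longer than [s]. By concavity one longer chord in the direction is enough; hence the
    alternative, for each direction, between a longer chord and none. *)

Definition has_chord (n : nat) (r p phi l : R) : Prop :=
  exists t, chord_param n r p phi t /\ chord_param n r p phi (t + l).

Lemma INR_gt0 (n : nat) : (0 < n)%nat -> 0 < INR n.
Proof. intros H; apply lt_0_INR; lia. Qed.

Lemma PI_div_n (n : nat) : (0 < n)%nat -> INR n * (PI / INR n) = PI.
Proof. intros H; apply INR_gt0 in H; field; lra. Qed.

Lemma cos_period_Z (x : R) (k : Z) : cos (x + 2 * IZR k * PI) = cos x.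
Proof.
  destruct (Z.le_ge_cases 0 k) as [H|H].
  - rewrite <- (Z2Nat.id k H), <- INR_IZR_INZ. apply cos_period.
  - rewrite <- (cos_period _ (Z.to_nat (- k))), INR_IZR_INZ, Z2Nat.id by lia.
    rewrite opp_IZR. f_equal; ring.
Qed.

Lemma sin_period_Z (x : R) (k : Z) : sin (x + 2 * IZR k * PI) = sin x.
Proof.
  destruct (Z.le_ge_cases 0 k) as [H|H].
  - rewrite <- (Z2Nat.id k H), <- INR_IZR_INZ. apply sin_period.
  - rewrite <- (sin_period _ (Z.to_nat (- k))), INR_IZR_INZ, Z2Nat.id by lia.
    rewrite opp_IZR. f_equal; ring.
Qed.

(** Edges are indexed by all integers from here on, so that the symmetries become index shifts;
    reduction modulo [n] changes the angle of a normal by full turns only. *)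
Lemma Z_mod_nat (n : nat) (z : Z) : (0 < n)%nat ->
  exists (j : nat) (q : Z), (j < n)%nat /\
    (2 * IZR z + 1) * (PI / INR n) = INR (2 * j + 1) * PI / INR n + 2 * IZR q * PI.
Proof.
  intros Hn. exists (Z.to_nat (z mod Z.of_nat n)), (z / Z.of_nat n)%Z.
  pose proof (Z.mod_pos_bound z (Z.of_nat n) ltac:(lia)) as B. split; [lia|].
  rewrite (Z.div_mod z (Z.of_nat n)) at 1 by lia.
  rewrite plus_IZR, mult_IZR, <- INR_IZR_INZ.
  rewrite plus_INR, mult_INR, (INR_IZR_INZ (Z.to_nat _)), Z2Nat.id by lia.
  apply INR_gt0 in Hn. simpl INR. field. lra.
Qed.

Lemma chord_paramE (n : nat) (r p phi t : R) : (0 < n)%nat ->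
  chord_param n r p phi t <->
  forall z : Z, p * cos ((2 * IZR z + 1) * (PI / INR n) - phi)
                + t * sin ((2 * IZR z + 1) * (PI / INR n) - phi)
                <= r * cos (PI / INR n).
Proof.
  intros Hn. unfold chord_param, in_polygon. split; intros H.
  - intros z. destruct (Z_mod_nat n z Hn) as (j & q & Hj & ->).
    specialize (H j Hj). eapply Rle_trans; [|exact H]. apply Req_le.
    rewrite cos_minus, sin_minus, cos_period_Z, sin_period_Z. ring.
  - intros j Hj. specialize (H (Z.of_nat j)). eapply Rle_trans; [|exact H].
    rewrite <- INR_IZR_INZ. apply Req_le.
    replace (INR (2 * j + 1) * PI / INR n) with ((2 * INR j + 1) * (PI / INR n))
      by (rewrite plus_INR, mult_INR; simpl; apply INR_gt0 in Hn; field; lra).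
    rewrite cos_minus, sin_minus. ring.
Qed.

Lemma chord_param_rotate (n : nat) (r p phi t : R) (m : Z) : (0 < n)%nat ->
  chord_param n r p (phi + 2 * IZR m * (PI / INR n)) t <-> chord_param n r p phi t.
Proof.
  intros Hn. rewrite !chord_paramE by assumption. split; intros H z.
  - specialize (H (z + m)%Z). rewrite plus_IZR in H.
    replace ((2 * (IZR z + IZR m) + 1) * (PI / INR n) - (phi + 2 * IZR m * (PI / INR n)))
      with ((2 * IZR z + 1) * (PI / INR n) - phi) in H by ring. exact H.
  - specialize (H (z - m)%Z). rewrite minus_IZR in H.
    replace ((2 * (IZR z - IZR m) + 1) * (PI / INR n) - phi)
      with ((2 * IZR z + 1) * (PI / INR n) - (phi + 2 * IZR m * (PI / INR n))) in H
      by ring. exact H.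
Qed.

Lemma chord_param_reflect (n : nat) (r p phi t : R) : (0 < n)%nat ->
  chord_param n r p phi t -> chord_param n r p (- phi) (- t).
Proof.
  intros Hn. rewrite !chord_paramE by assumption. intros H z.
  (* The reflection exchanges the normals at [2 z + 1] and [2 (- z - 1) + 1 = - (2 z + 1)] times
     [PI / INR n]. *)
  specialize (H (- z - 1)%Z). rewrite minus_IZR, opp_IZR in H.
  replace ((2 * (- IZR z - 1) + 1) * (PI / INR n) - phi)
    with (- ((2 * IZR z + 1) * (PI / INR n) - - phi)) in H by ring.
  rewrite cos_neg, sin_neg in H. lra.
Qed.

Lemma chord_param_opp (n : nat) (r p phi t : R) :
  chord_param n r p (phi + PI) t <-> chord_param n r (- p) phi (- t).
Proof.
  unfold chord_param. rewrite neg_cos, neg_sin.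
  replace (- p * cos phi - - t * sin phi) with (p * - cos phi - t * - sin phi) by ring.
  replace (- p * sin phi + - t * cos phi) with (p * - sin phi + t * - cos phi) by ring.
  tauto.
Qed.

Lemma has_chord_rotate (n : nat) (r p phi l : R) (m : Z) : (0 < n)%nat ->
  has_chord n r p (phi + 2 * IZR m * (PI / INR n)) l <-> has_chord n r p phi l.
Proof.
  intros Hn. unfold has_chord.
  split; intros (t & H1 & H2); exists t; revert H1 H2;
    rewrite !chord_param_rotate by assumption; tauto.
Qed.

Lemma has_chord_reflect (n : nat) (r p phi l : R) : (0 < n)%nat ->
  has_chord n r p (- phi) l <-> has_chord n r p phi l.
Proof.
  intros Hn.
  assert (H : forall phi, has_chord n r p phi l -> has_chord n r p (- phi) l).
  { intros f (t & H1 & H2). exists (- (t + l)).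
    split; [|replace (- (t + l) + l) with (- t) by ring];
      apply chord_param_reflect; assumption. }
  split; intros G; [rewrite <- (Ropp_involutive phi)|]; auto.
Qed.

Lemma has_chord_opp (n : nat) (r p phi l : R) :
  has_chord n r p (phi + PI) l <-> has_chord n r (- p) phi l.
Proof.
  split; intros (t & H1 & H2).
  - exists (- (t + l)). replace (- (t + l) + l) with (- t) by ring.
    rewrite <- !chord_param_opp. tauto.
  - exists (- (t + l)). rewrite !chord_param_opp.
    replace (- - (t + l)) with (t + l) by ring.
    replace (- (- (t + l) + l)) with t by ring. tauto.
Qed.

Lemma chord_param_convex (n : nat) (r p1 p2 t1 t2 phi w : R) : (0 < n)%nat ->
  0 <= w <= 1 -> chord_param n r p1 phi t1 -> chord_param n r p2 phi t2 ->
  chord_param n r (w * p1 + (1 - w) * p2) phi (w * t1 + (1 - w) * t2).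
Proof.
  intros Hn Hw. rewrite !chord_paramE by assumption. intros H1 H2 z.
  specialize (H1 z); specialize (H2 z). nra.
Qed.

(** Convex combinations of both endpoints stay in the polygon: this is the concavity of the chord
    length in [p]. *)
Lemma has_chord_convex (n : nat) (r p1 p2 l1 l2 phi w : R) : (0 < n)%nat ->
  0 <= w <= 1 -> has_chord n r p1 phi l1 -> has_chord n r p2 phi l2 ->
  has_chord n r (w * p1 + (1 - w) * p2) phi (w * l1 + (1 - w) * l2).
Proof.
  intros Hn Hw (t1 & H1 & H1') (t2 & H2 & H2').
  exists (w * t1 + (1 - w) * t2). split; [apply chord_param_convex; assumption|].
  replace (w * t1 + (1 - w) * t2 + (w * l1 + (1 - w) * l2))
    with (w * (t1 + l1) + (1 - w) * (t2 + l2)) by ring.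
  apply chord_param_convex; assumption.
Qed.

Lemma has_chord_zero (n : nat) (r p phi l : R) :
  has_chord n r p phi l -> has_chord n r p phi 0.
Proof. intros (t & H & _). exists t. rewrite Rplus_0_r. tauto. Qed.

Lemma has_chord_le (n : nat) (r p phi l l' : R) : (0 < n)%nat ->
  0 <= l' <= l -> has_chord n r p phi l -> has_chord n r p phi l'.
Proof.
  intros Hn Hl H. destruct (Req_dec l 0) as [->|Hl0].
  { replace l' with 0 by lra. exact H. }
  assert (W : 0 <= l' / l <= 1).
  { split; [apply Rle_mult_inv_pos; lra|].
    apply Rmult_le_reg_r with l; [lra|]. field_simplify; lra. }
  pose proof (has_chord_convex n r p p l 0 phi (l' / l) Hn W H (has_chord_zero _ _ _ _ _ H)) as G.
  replace (l' / l * p + (1 - l' / l) * p) with p in G by ring.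
  replace (l' / l * l + (1 - l' / l) * 0) with l' in G by (field; lra). exact G.
Qed.

(** A vertex direction and an edge normal differ by an odd multiple of [PI / INR n], so this places
    the vertices in the polygon. *)
Lemma cos_odd_le (n : nat) (z : Z) : (0 < n)%nat ->
  cos ((2 * IZR z + 1) * (PI / INR n)) <= cos (PI / INR n).
Proof.
  intros Hn. destruct (Z_mod_nat n z Hn) as (j & q & Hj & ->).
  rewrite cos_period_Z, plus_INR, mult_INR. change (INR 2) with 2. change (INR 1) with 1.
  pose proof (PI_div_n n Hn) as Ha. pose proof PI_RGT_0. pose proof (INR_gt0 n Hn) as Hn'.
  set (a := PI / INR n) in *.
  replace ((2 * INR j + 1) * PI / INR n) with ((2 * INR j + 1) * a)
    by (unfold a; field; lra).
  assert (0 < a) by (apply Rdiv_lt_0_compat; assumption).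
  assert (B : 0 <= INR j <= INR n - 1).
  { split; [apply pos_INR|]. apply (le_INR (S j)) in Hj. rewrite S_INR in Hj. lra. }
  assert (1 <= INR n) by (apply (le_INR 1); lia).
  assert (J : 0 <= INR j * a <= PI - a).
  { split; [apply Rmult_le_pos; lra|]. rewrite <- Ha.
    replace (INR n * a - a) with ((INR n - 1) * a) by ring.
    apply Rmult_le_compat_r; lra. }
  destruct (Rle_dec ((2 * INR j + 1) * a) PI) as [C|C].
  - apply cos_decr_1; lra.
  - rewrite <- (cos_neg (_ * a)), <- (cos_period_Z _ 1).
    apply cos_decr_1; lra.
Qed.

(** These are the coordinates [p] and [t] of the point of edge [z] at signed distance [u] from its
    midpoint. An edge inequality is linear in [u], hence follows from those at the two end vertices,
    given by [cos_odd_le]. *)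
Lemma edge_point (n : nat) (r phi u : R) (z : Z) : (0 < n)%nat -> 0 < r ->
  - (r * sin (PI / INR n)) <= u <= r * sin (PI / INR n) ->
  let d := (2 * IZR z + 1) * (PI / INR n) - phi in
  chord_param n r (r * cos (PI / INR n) * cos d - u * sin d) phi
    (r * cos (PI / INR n) * sin d + u * cos d).
Proof.
  intros Hn Hr Hu d. rewrite chord_paramE by assumption. intros z'.
  set (D := _ - phi).
  replace ((r * cos (PI / INR n) * cos d - u * sin d) * cos D
           + (r * cos (PI / INR n) * sin d + u * cos d) * sin D)
    with (r * cos (PI / INR n) * cos (D - d) + u * sin (D - d))
    by (rewrite cos_minus, sin_minus; ring).
  set (e := D - d).
  assert (E1 : cos (e - PI / INR n) <= cos (PI / INR n)).
  { replace (e - PI / INR n) with ((2 * IZR (z' - z - 1) + 1) * (PI / INR n))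
      by (unfold e, D, d; rewrite !minus_IZR; ring).
    apply cos_odd_le; assumption. }
  assert (E2 : cos (e + PI / INR n) <= cos (PI / INR n)).
  { replace (e + PI / INR n) with ((2 * IZR (z' - z) + 1) * (PI / INR n))
      by (unfold e, D, d; rewrite !minus_IZR; ring).
    apply cos_odd_le; assumption. }
  rewrite cos_minus in E1. rewrite cos_plus in E2.
  destruct (Rle_dec 0 (sin e)).
  - assert (u * sin e <= r * sin (PI / INR n) * sin e) by (apply Rmult_le_compat_r; lra).
    nra.
  - assert (u * sin e <= - (r * sin (PI / INR n)) * sin e) by nra. nra.
Qed.

(* Level [p] at which a line whose normal makes the angle [psi] with the bisector of two
   edges, [q] edges apart, cuts a segment of length [s] between the edge lines. *)
Definition level (n : nat) (r s : R) (q : nat) (psi : R) : R :=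
  r * cos (PI / INR n) / cos (INR q * (PI / INR n)) * cos psi
  - s / (2 * sin (2 * (INR q * (PI / INR n))))
    * (cos (2 * psi) - cos (2 * (INR q * (PI / INR n)))).

Lemma mul_sin_sin (x y : R) : sin (x - y) * sin (x + y) = (cos (2 * y) - cos (2 * x)) / 2.
Proof.
  replace (2 * y) with ((x + y) - (x - y)) by ring.
  replace (2 * x) with ((x + y) + (x - y)) by ring.
  rewrite (cos_minus (x + y)), (cos_plus (x + y)). field.
Qed.

Lemma angle_lt_half (n q : nat) : (0 < q)%nat -> (2 * q < n)%nat ->
  0 < INR q * (PI / INR n) < PI / 2.
Proof.
  intros Hq Hn. pose proof PI_RGT_0. pose proof (PI_div_n n ltac:(lia)) as Ha.
  pose proof (INR_gt0 n ltac:(lia)). pose proof (INR_gt0 q Hq).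
  assert (0 < PI / INR n) by (apply Rdiv_lt_0_compat; assumption).
  apply lt_INR in Hn. rewrite mult_INR in Hn. simpl (INR 2) in Hn. nra.
Qed.

(** The edges are [0] and [-q], whose normals make the angles [Q] and [-Q] with their bisector,
    where [Q] is [q] times [PI / INR n]. The two inequalities keep the endpoints of the segment
    within the edges; since [sin (Q - psi) <= sin (Q + psi)], a lower bound on the first and an
    upper bound on the second cover both endpoints. *)
Lemma level_has_chord (n : nat) (r s : R) (q : nat) (psi : R) :
  (0 < q)%nat -> (2 * q < n)%nat -> 0 < r -> 0 <= s -> 0 <= psi <= PI / INR n ->
  2 * r * sin ((INR q - 1) * (PI / INR n)) * sin (INR q * (PI / INR n))
    <= s * sin (INR q * (PI / INR n) - psi) ->
  s * sin (INR q * (PI / INR n) + psi)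
    <= 2 * r * sin (INR q * (PI / INR n)) * sin ((INR q + 1) * (PI / INR n)) ->
  has_chord n r (level n r s q psi) (psi + (1 - INR q) * (PI / INR n)) s.
Proof.
  intros Hq Hn Hr Hs Hpsi H1 H2.
  pose proof (angle_lt_half n q Hq Hn) as HQ.
  assert (Hn0 : (0 < n)%nat) by lia. assert (Hn3 : (2 < n)%nat) by lia.
  pose proof (angle_lt_half n 1 ltac:(lia) ltac:(lia)) as Ha. simpl INR in Ha.
  unfold level. set (a := PI / INR n) in *.
  replace ((INR q - 1) * a) with (INR q * a - a) in H1 by ring.
  replace ((INR q + 1) * a) with (INR q * a + a) in H2 by ring.
  remember (INR q * a) as Q.
  assert (SQ : 0 < sin Q) by (apply sin_gt_0; lra).
  assert (CQ : 0 < cos Q) by (apply cos_gt_0; lra).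
  assert (Sp : 0 <= sin psi) by (apply sin_ge_0; lra).
  assert (Mono : sin (Q - psi) <= sin (Q + psi)) by (rewrite sin_minus, sin_plus; nra).
  assert (K1 : cos Q * cos (Q - psi) + sin Q * sin (Q - psi) = cos psi).
  { rewrite <- cos_minus. f_equal; ring. }
  assert (K1' : cos Q * cos (Q + psi) + sin Q * sin (Q + psi) = cos psi).
  { rewrite <- cos_minus, <- (cos_neg psi). f_equal; ring. }
  assert (K3 : cos Q * (sin (Q - psi) + sin (Q + psi)) =
               sin Q * (cos (Q - psi) + cos (Q + psi))).
  { rewrite sin_minus, sin_plus, cos_minus, cos_plus; ring. }
  pose proof (mul_sin_sin Q psi) as K2.
  assert (K4 : sin (Q - psi) * cos (Q + psi) + cos (Q - psi) * sin (Q + psi)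
               = 2 * sin Q * cos Q).
  { rewrite <- sin_plus, <- sin_2a. f_equal; ring. }
  assert (U : forall y, 2 * r * sin (Q - a) * sin Q <= s * y ->
     s * y <= 2 * r * sin Q * sin (Q + a) ->
     - (r * sin a) <= s * y / (2 * sin Q * cos Q) - r * cos a * sin Q / cos Q <= r * sin a).
  { intros y Y1 Y2. rewrite sin_minus in Y1. rewrite sin_plus in Y2.
    split; apply Rmult_le_reg_r with (2 * sin Q * cos Q); try nra;
    replace ((s * y / (2 * sin Q * cos Q) - r * cos a * sin Q / cos Q) * (2 * sin Q * cos Q))
      with (s * y - 2 * r * cos a * sin Q * sin Q) by (field; lra); nra. }
  pose proof (U (sin (Q + psi)) ltac:(nra) ltac:(nra)) as UX.
  pose proof (U (sin (Q - psi)) ltac:(nra) ltac:(nra)) as UY.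
  (* Law of sines in the triangle cut off by the edge lines: the endpoints are at distance
     [s * sin (Q + psi) / sin (2 * Q)] and [s * sin (Q - psi) / sin (2 * Q)] from the apex, and the
     midpoints of the edges at distance [r * cos a * sin Q / cos Q]. The offsets point away from the
     apex, which is against the orientation of edge [-q]; hence [- uY] below. *)
  remember (s * sin (Q + psi) / (2 * sin Q * cos Q) - r * cos a * sin Q / cos Q) as uX.
  remember (s * sin (Q - psi) / (2 * sin Q * cos Q) - r * cos a * sin Q / cos Q) as uY.
  pose proof (edge_point n r (psi + (1 - INR q) * a) uX 0 Hn0 Hr UX) as PX.
  assert (UY' : - (r * sin a) <= - uY <= r * sin a) by lra.
  pose proof (edge_point n r (psi + (1 - INR q) * a) (- uY) (- Z.of_nat q) Hn0 Hr UY') as PY.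
  cbv zeta in PX, PY. fold a in PX, PY.
  replace ((2 * IZR 0 + 1) * a - (psi + (1 - INR q) * a)) with (Q - psi) in PX
    by (rewrite HeqQ; simpl; ring).
  rewrite opp_IZR, <- INR_IZR_INZ in PY.
  replace ((2 * - INR q + 1) * a - (psi + (1 - INR q) * a)) with (- (Q + psi)) in PY
    by (rewrite HeqQ; ring).
  rewrite cos_neg, sin_neg in PY. rewrite sin_2a.
  exists (r * cos a * - sin (Q + psi) + - uY * cos (Q + psi)). split.
  - replace (r * cos a / cos Q * cos psi
        - s / (2 * (2 * sin Q * cos Q)) * (cos (2 * psi) - cos (2 * Q)))
      with (r * cos a * cos (Q + psi) - - uY * - sin (Q + psi)); [exact PY|].
    replace (cos (2 * psi) - cos (2 * Q)) with (2 * (sin (Q - psi) * sin (Q + psi))) by lra.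
    rewrite <- K1', HequY. field. lra.
  - replace (r * cos a / cos Q * cos psi
        - s / (2 * (2 * sin Q * cos Q)) * (cos (2 * psi) - cos (2 * Q)))
      with (r * cos a * cos (Q - psi) - uX * sin (Q - psi)).
    + replace (r * cos a * - sin (Q + psi) + - uY * cos (Q + psi) + s)
        with (r * cos a * sin (Q - psi) + uX * cos (Q - psi)); [exact PX|].
      rewrite HequX, HequY.
      apply Rmult_eq_reg_r with (2 * sin Q * cos Q); [|nra].
      transitivity (2 * r * cos a * sin Q * (cos Q * (sin (Q - psi)) - sin Q * cos (Q - psi))
         + s * (cos (Q - psi) * sin (Q + psi))); [field; lra|].
      replace (cos (Q - psi) * sin (Q + psi))
        with (2 * sin Q * cos Q - sin (Q - psi) * cos (Q + psi)) by lra.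
      replace (cos Q * sin (Q - psi) - sin Q * cos (Q - psi))
        with (sin Q * cos (Q + psi) - cos Q * sin (Q + psi)) by lra.
      field. lra.
    + replace (cos (2 * psi) - cos (2 * Q)) with (2 * (sin (Q - psi) * sin (Q + psi))) by lra.
      rewrite <- K1, HequX. field. lra.
Qed.

(** The start of the segment obeys the inequality of edge [-q] and its end that of edge [0]; the
    nonnegative weights [sin (Q - psi)] and [sin (Q + psi)] eliminate [t]. The case [2 * q = n] of
    parallel edges is included: there the coefficient of [p] vanishes and a bound on [l] remains. *)
Lemma has_chord_edge_pair (n : nat) (r l : R) (q : nat) (psi p : R) :
  (0 < q)%nat -> (2 * q <= n)%nat -> (1 < n)%nat -> 0 <= psi <= PI / INR n ->
  has_chord n r p (psi + (1 - INR q) * (PI / INR n)) l ->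
  p * sin (2 * (INR q * (PI / INR n)))
    + l * (sin (INR q * (PI / INR n) - psi) * sin (INR q * (PI / INR n) + psi))
  <= r * cos (PI / INR n) * (2 * sin (INR q * (PI / INR n)) * cos psi).
Proof.
  intros Hq Hn Hn1 Hpsi (t & T1 & T2).
  assert (Hn0 : (0 < n)%nat) by lia.
  rewrite chord_paramE in T1, T2 by assumption.
  specialize (T1 (- Z.of_nat q)%Z). specialize (T2 0%Z).
  rewrite opp_IZR, <- INR_IZR_INZ in T1.
  assert (HQ : PI / INR n <= INR q * (PI / INR n) <= PI / 2).
  { pose proof (PI_div_n n Hn0) as Hpi.
    assert (1 <= INR q) by (apply (le_INR 1); lia).
    apply le_INR in Hn. rewrite mult_INR in Hn. simpl (INR 2) in Hn. nra. }
  set (a := PI / INR n) in *.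
  remember (INR q * a) as Q.
  replace ((2 * - INR q + 1) * a - (psi + (1 - INR q) * a)) with (- (Q + psi)) in T1
    by (rewrite HeqQ; ring).
  replace ((2 * IZR 0 + 1) * a - (psi + (1 - INR q) * a)) with (Q - psi) in T2
    by (rewrite HeqQ; simpl; ring).
  rewrite cos_neg, sin_neg in T1.
  assert (S1 : 0 <= sin (Q - psi)) by (apply sin_ge_0; lra).
  assert (S2 : 0 <= sin (Q + psi)) by (apply sin_ge_0; lra).
  replace (sin (2 * Q))
    with (sin (Q - psi) * cos (Q + psi) + cos (Q - psi) * sin (Q + psi))
    by (rewrite <- sin_plus; f_equal; ring).
  replace (2 * sin Q * cos psi) with (sin (Q - psi) + sin (Q + psi))
    by (rewrite sin_minus, sin_plus; ring).
  apply (Rmult_le_compat_l _ _ _ S1) in T1. apply (Rmult_le_compat_l _ _ _ S2) in T2. lra.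
Qed.

Lemma has_chord_le_level (n : nat) (r s : R) (q : nat) (psi p : R) :
  (0 < q)%nat -> (2 * q < n)%nat -> 0 <= psi <= PI / INR n ->
  has_chord n r p (psi + (1 - INR q) * (PI / INR n)) s -> p <= level n r s q psi.
Proof.
  intros Hq Hn Hpsi H.
  apply has_chord_edge_pair in H; [|lia..|assumption].
  pose proof (angle_lt_half n q Hq Hn) as HQ.
  unfold level. set (a := PI / INR n) in *. remember (INR q * a) as Q.
  assert (SQ : 0 < sin Q) by (apply sin_gt_0; lra).
  assert (CQ : 0 < cos Q) by (apply cos_gt_0; lra).
  rewrite mul_sin_sin, sin_2a in H. rewrite sin_2a.
  apply Rmult_le_reg_r with (2 * sin Q * cos Q); [nra|].
  replace ((r * cos a / cos Q * cos psi
      - s / (2 * (2 * sin Q * cos Q)) * (cos (2 * psi) - cos (2 * Q))) * (2 * sin Q * cos Q))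
    with (r * cos a * (2 * sin Q * cos psi) - s * ((cos (2 * psi) - cos (2 * Q)) / 2))
    by (field; lra).
  lra.
Qed.

(** * Integration over the lines of a direction and over the directions *)

Lemma chord_leE (n : nat) (r p phi s : R) :
  chord_le n r p phi s <-> forall l, 0 <= l -> has_chord n r p phi l -> l <= s.
Proof.
  split.
  - intros H l Hl (t & T1 & T2). specialize (H _ _ T2 T1).
    rewrite Rabs_right in H; lra.
  - intros H t1 t2 T1 T2. apply H; [apply Rabs_pos|].
    destruct (Rle_dec t1 t2).
    + exists t1. rewrite Rabs_left1 by lra. replace (t1 + - (t1 - t2)) with t2 by ring. tauto.
    + exists t2. rewrite Rabs_right by lra. replace (t2 + (t1 - t2)) with t1 by ring. tauto.
Qed.

Lemma meetsE (n : nat) (r p phi : R) : meets n r p phi <-> has_chord n r p phi 0.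
Proof.
  split; intros (t & H); exists t; revert H; rewrite ?Rplus_0_r; tauto.
Qed.

Lemma ind_one (n : nat) (r s phi p : R) :
  has_chord n r p phi 0 -> (forall l, 0 <= l -> has_chord n r p phi l -> l <= s) ->
  ind n r s phi p = 1.
Proof.
  intros H1 H2. unfold ind. destruct excluded_middle_informative as [H|H]; [reflexivity|].
  exfalso. apply H. rewrite meetsE, chord_leE. tauto.
Qed.

(** The implication covers both reasons for the value [0]: the line misses the polygon, or its chord
    is too long. *)
Lemma ind_zero (n : nat) (r s phi p l : R) :
  0 <= l -> s < l -> (has_chord n r p phi 0 -> has_chord n r p phi l) ->
  ind n r s phi p = 0.
Proof.
  intros Hl Hsl H. unfold ind. destruct excluded_middle_informative as [[H1 H2]|_]; [|reflexivity].
  exfalso. rewrite meetsE in H1. rewrite chord_leE in H2. specialize (H2 l Hl (H H1)). lra.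
Qed.

Lemma ind_ext (n : nat) (r s phi phi' p : R) :
  (forall l, has_chord n r p phi l <-> has_chord n r p phi' l) ->
  ind n r s phi p = ind n r s phi' p.
Proof.
  intros H. unfold ind.
  assert (E : (meets n r p phi /\ chord_le n r p phi s) <->
              (meets n r p phi' /\ chord_le n r p phi' s)).
  { rewrite !meetsE, !chord_leE, H.
    split; intros (H1 & H2); (split; [exact H1|]); intros l Hl Hc;
      apply H2; try assumption; apply H; assumption. }
  do 2 destruct excluded_middle_informative; tauto.
Qed.

(** The direction [phi + PI] brought back to the sector by the dihedral symmetry; for even [n] the
    polygon is centrally symmetric. *)
Definition antipode (n : nat) (phi : R) : R :=
  if Nat.even n then phi else PI / INR n - phi.

Lemma has_chord_antipode (n : nat) (r p phi l : R) : (0 < n)%nat ->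
  has_chord n r p (antipode n phi) l <-> has_chord n r (- p) phi l.
Proof.
  intros Hn. rewrite <- has_chord_opp. unfold antipode.
  pose proof (PI_div_n n Hn) as Ha. set (a := PI / INR n) in *.
  destruct (Nat.even n) eqn:En.
  - apply Nat.even_spec in En. destruct En as (m & En).
    rewrite <- (has_chord_rotate n r p phi l (Z.of_nat m) Hn).
    fold a. rewrite <- INR_IZR_INZ, <- Ha, En, mult_INR. simpl (INR 2). tauto.
  - assert (En' : Nat.odd n = true) by (rewrite <- Nat.negb_even, En; reflexivity).
    apply Nat.odd_spec in En'. destruct En' as (m & En').
    rewrite <- has_chord_reflect by assumption.
    rewrite <- (has_chord_rotate n r p (- (a - phi)) l (Z.of_nat (m + 1)) Hn).
    fold a. rewrite <- INR_IZR_INZ, <- Ha, En', !plus_INR, mult_INR. simpl (INR 2). simpl (INR 1).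
    replace (- (a - phi) + 2 * (INR m + 1) * a) with (phi + (2 * INR m + 1) * a) by ring. tauto.
Qed.

(** For [s = 0] this [b] is the support function of the polygon. *)
Definition is_top (n : nat) (r phi s b : R) : Prop :=
  has_chord n r b phi s /\ forall p, has_chord n r p phi s -> p <= b.

Lemma is_RInt_piece (f : R -> R) (a b v : R) : a <= b ->
  (forall x, a < x < b -> f x = v) -> RInt.is_RInt f a b (v * (b - a)).
Proof.
  intros Hab H. apply is_RInt_ext with (fun _ => v).
  - intros x. rewrite Rmin_left, Rmax_right by assumption. intros Hx. symmetry; auto.
  - rewrite Rmult_comm.
    exact (is_RInt_const a b v).
Qed.

Lemma is_RInt_concat (f : R -> R) (a b c u v : R) :
  RInt.is_RInt f a b u -> RInt.is_RInt f b c v -> RInt.is_RInt f a c (u + v).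
Proof. intros H1 H2. exact (is_RInt_Chasles f a b c u v H1 H2). Qed.

Lemma between_weight (x y z : R) : x < z < y ->
  exists w, 0 < w < 1 /\ z = w * x + (1 - w) * y.
Proof.
  intros H. exists ((y - z) / (y - x)). split.
  - split; [apply Rdiv_lt_0_compat; lra|].
    apply Rmult_lt_reg_r with (y - x); [lra|]. field_simplify; lra.
  - field. lra.
Qed.

Lemma has_chord_between (n : nat) (r phi p1 p2 p l : R) : (0 < n)%nat ->
  has_chord n r p1 phi l -> has_chord n r p2 phi l -> p1 <= p <= p2 ->
  has_chord n r p phi l.
Proof.
  intros Hn H1 H2 [[Hp | <-] [Hp' | ->]]; try assumption.
  destruct (between_weight p1 p2 p (conj Hp Hp')) as (w & Hw & ->).
  replace l with (w * l + (1 - w) * l) by ring.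
  apply has_chord_convex; auto; lra.
Qed.

(* The chord length is concave in [p], so a single chord longer than [s] makes it exceed [s]
   strictly between any two lines with chords of length [s]. *)
Lemma has_longer_chord (n : nat) (r phi p1 p2 p p0 s s' : R) : (0 < n)%nat ->
  has_chord n r p1 phi s -> has_chord n r p2 phi s -> has_chord n r p0 phi s' ->
  s < s' -> p1 < p < p2 -> exists l, s < l /\ has_chord n r p phi l.
Proof.
  intros Hn H1 H2 H0 Hs Hp.
  destruct (Rtotal_order p p0) as [L | [-> | L]].
  - destruct (between_weight p1 p0 p ltac:(lra)) as (w & Hw & ->).
    exists (w * s + (1 - w) * s'). split; [nra|]. apply has_chord_convex; auto; lra.
  - exists s'; tauto.
  - destruct (between_weight p0 p2 p ltac:(lra)) as (w & Hw & ->).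
    exists (w * s' + (1 - w) * s). split; [nra|]. apply has_chord_convex; auto; lra.
Qed.

(** The line meets the polygon for [p] in [[- h', h]], and its chord is longer than [s] strictly
    between [- b'] and [b]. The maxima truncate this to [p >= 0], whatever the signs of [b] and
    [b']. *)
Lemma ind_RInt_long (n : nat) (r phi s h h' b b' p0 s' : R) : (0 < n)%nat -> 0 <= s ->
  is_top n r phi 0 h -> is_top n r (antipode n phi) 0 h' ->
  is_top n r phi s b -> is_top n r (antipode n phi) s b' ->
  0 <= h <= r -> 0 <= h' -> s < s' -> has_chord n r p0 phi s' ->
  RInt.is_RInt (ind n r s phi) 0 r (h - Rmax b 0 + Rmax (- b') 0).
Proof.
  intros Hn Hs [Th Mh] [Th' Mh'] [Tb Mb] [Tb' Mb'] Hh Hh' Hs' H0.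
  rewrite has_chord_antipode in Th', Tb' by assumption.
  assert (Mb'2 : forall p, has_chord n r p phi s -> - b' <= p).
  { intros p H. assert (- p <= b'); [|lra]. apply Mb'.
    rewrite has_chord_antipode, Ropp_involutive by assumption. exact H. }
  assert (Meet : forall p, 0 <= p <= h -> has_chord n r p phi 0).
  { intros p Hp. apply (has_chord_between n r phi (- h') h); auto; lra. }
  assert (One : forall p, 0 <= p <= h -> p < - b' \/ b < p -> ind n r s phi p = 1).
  { intros p Hp Hp'. apply ind_one; auto. intros l Hl Hc.
    destruct (Rle_dec l s) as [|C]; [assumption|exfalso].
    apply (has_chord_le n r p phi l s Hn ltac:(lra)) in Hc.
    pose proof (Mb'2 _ Hc). pose proof (Mb _ Hc). lra. }
  pose proof (Mb'2 _ Tb) as Hbb.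
  assert (Hbh : b <= h) by (apply Mh; apply has_chord_zero in Tb; exact Tb).
  pose proof (Rmax_l b 0). pose proof (Rmax_r b 0).
  pose proof (Rmax_l (- b') 0). pose proof (Rmax_r (- b') 0).
  assert (M1 : Rmax (- b') 0 <= Rmax b 0) by (apply Rmax_case; lra).
  assert (M2 : Rmax b 0 <= h) by (apply Rmax_case; lra).
  replace (h - Rmax b 0 + Rmax (- b') 0)
    with (1 * (Rmax (- b') 0 - 0) + 0 * (Rmax b 0 - Rmax (- b') 0)
          + 1 * (h - Rmax b 0) + 0 * (r - h)) by ring.
  apply is_RInt_concat with h; [apply is_RInt_concat with (Rmax b 0);
    [apply is_RInt_concat with (Rmax (- b') 0)|]|];
    apply is_RInt_piece; try lra; intros p Hp.
  - apply One; [lra|left]. revert Hp. apply Rmax_case_strong; lra.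
  - destruct (has_longer_chord n r phi (- b') b p p0 s s' Hn Tb' Tb H0 Hs') as (l & Hl & Hc).
    { revert Hp. do 2 apply Rmax_case_strong; lra. }
    apply ind_zero with l; auto; lra.
  - apply One; lra.
  - apply ind_zero with (s + 1); try lra. intros C. apply Mh in C. lra.
Qed.

Lemma ind_RInt_short (n : nat) (r phi s h h' : R) : (0 < n)%nat ->
  is_top n r phi 0 h -> is_top n r (antipode n phi) 0 h' ->
  0 <= h <= r -> 0 <= h' ->
  (forall p l, 0 <= l -> has_chord n r p phi l -> l <= s) ->
  RInt.is_RInt (ind n r s phi) 0 r h.
Proof.
  intros Hn [Th Mh] [Th' Mh'] Hh Hh' Hs.
  rewrite has_chord_antipode in Th' by assumption.
  replace h with (1 * (h - 0) + 0 * (r - h)) by ring.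
  apply is_RInt_concat with h; apply is_RInt_piece; try lra; intros p Hp.
  - apply ind_one; [|intros l; apply Hs].
    apply (has_chord_between n r phi (- h') h); auto; lra.
  - assert (0 <= Rabs s) by apply Rabs_pos.
    pose proof (Rle_abs s). apply ind_zero with (Rabs s + 1); try lra.
    intros C. apply Mh in C. lra.
Qed.

(** * Reduction of the integral over the directions to one sector *)

Lemma is_RInt_reflect (f : R -> R) (a b c I : R) :
  RInt.is_RInt f a b I -> RInt.is_RInt (fun x => f (c - x)) (c - b) (c - a) I.
Proof.
  intros H. apply is_RInt_swap in H.
  assert (H' : RInt.is_RInt f (-1 * (c - b) + c) (-1 * (c - a) + c) (opp I)).
  { replace (-1 * (c - b) + c) with b by ring.
    replace (-1 * (c - a) + c) with a by ring. exact H. }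
  apply is_RInt_comp_lin in H'. apply (is_RInt_scal _ _ _ (-1)) in H'.
  replace I with (-1 * - I) by ring.
  eapply is_RInt_ext; [|exact H']. intros x _.
  change (-1 * (-1 * f (-1 * x + c)) = f (c - x)).
  replace (-1 * x + c) with (c - x) by ring. ring.
Qed.

Lemma is_RInt_shift (f : R -> R) (a b c I : R) :
  RInt.is_RInt f (a + c) (b + c) I -> RInt.is_RInt (fun x => f (x + c)) a b I.
Proof.
  intros H.
  assert (H' : RInt.is_RInt f (1 * a + c) (1 * b + c) I) by (rewrite !Rmult_1_l; exact H).
  apply is_RInt_comp_lin in H'. eapply is_RInt_ext; [|exact H'].
  intros x _. change (1 * f (1 * x + c) = f (x + c)). rewrite !Rmult_1_l. reflexivity.
Qed.

Lemma is_RInt_even_periodic (f : R -> R) (a I : R) (n : nat) :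
  (forall x, f (x + 2 * a) = f x) -> (forall x, f (- x) = f x) ->
  RInt.is_RInt f 0 a I ->
  RInt.is_RInt f 0 (2 * INR n * a) (2 * INR n * I).
Proof.
  intros Hper Heven H.
  assert (H2 : RInt.is_RInt f 0 (2 * a) (I + I)).
  { apply is_RInt_concat with a; [exact H|].
    apply (is_RInt_reflect f 0 a (2 * a)) in H.
    replace (2 * a - a) with a in H by ring. replace (2 * a - 0) with (2 * a) in H by ring.
    eapply is_RInt_ext; [|exact H]. intros x _. simpl.
    replace (2 * a - x) with (- x + 2 * a) by ring. rewrite Hper. apply Heven. }
  assert (Hper' : forall m x, f (x - 2 * INR m * a) = f x).
  { induction m as [|m IH]; intros x; [simpl; f_equal; ring|].
    rewrite <- Hper, S_INR, <- (IH x). f_equal; ring. }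
  induction n as [|n IH].
  - simpl. rewrite Rmult_0_r, !Rmult_0_l. exact (is_RInt_point f 0).
  - replace (2 * INR (S n) * I) with (2 * INR n * I + (I + I)) by (rewrite S_INR; ring).
    apply is_RInt_concat with (2 * INR n * a); [exact IH|].
    eapply is_RInt_ext; [|apply (is_RInt_shift f _ _ (- (2 * INR n * a)))].
    + intros x _. apply Hper'.
    + rewrite S_INR.
      replace (2 * INR n * a + - (2 * INR n * a)) with 0 by ring.
      replace (2 * (INR n + 1) * a + - (2 * INR n * a)) with (2 * a) by ring. exact H2.
Qed.

Lemma is_RInt_of_Coquelicot (f : R -> R) (a b I : R) : RInt.is_RInt f a b I -> is_RInt f a b I.
Proof.
  intros H. exists (ex_RInt_Reals_0 f a b (ex_intro _ I H)).
  rewrite <- RInt_Reals. apply is_RInt_unique, H.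
Qed.

(** The positive and negative parts are half of [Rabs f] plus or minus [f]. Only the difference of
    their integrals matters below; [J] cancels. *)
Lemma is_RInt_Rmax0 (f : R -> R) (a b I : R) : RInt.is_RInt f a b I ->
  exists J, RInt.is_RInt (fun x => Rmax (f x) 0) a b J /\
            RInt.is_RInt (fun x => Rmax (- f x) 0) a b (J - I).
Proof.
  intros H.
  destruct (ex_RInt_norm f a b (ex_intro _ I H)) as (N & HN).
  change (fun x => norm (f x)) with (fun x => Rabs (f x)) in HN.
  exists (/ 2 * (I + N)). split.
  - eapply is_RInt_ext; [|exact (is_RInt_scal _ _ _ (/ 2) _ (is_RInt_plus _ _ _ _ _ _ H HN))].
    intros x _. change (/ 2 * (f x + Rabs (f x)) = Rmax (f x) 0).
    unfold Rabs, Rmax. destruct Rcase_abs, Rle_dec; lra.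
  - replace (/ 2 * (I + N) - I) with (/ 2 * (N - I)) by field.
    eapply is_RInt_ext; [|exact (is_RInt_scal _ _ _ (/ 2) _ (is_RInt_minus _ _ _ _ _ _ HN H))].
    intros x _. change (/ 2 * (Rabs (f x) + - f x) = Rmax (- f x) 0).
    unfold Rabs, Rmax. destruct Rcase_abs, Rle_dec; lra.
Qed.

Lemma is_RInt_scal_cos (r a : R) : RInt.is_RInt (fun x => r * cos x) 0 a (r * sin a).
Proof.
  replace (r * sin a) with (r * sin a + - (r * sin 0)) by (rewrite sin_0; ring).
  apply (is_RInt_derive (fun x => r * sin x)).
  - intros x _. auto_derive; [exact Logic.I|ring].
  - intros x _. apply continuity_pt_filterlim. reg.
Qed.

Lemma fold_angle (a phi : R) : 0 < a ->
  exists (m : Z) (x : R), 0 <= x <= a /\ (phi = x + 2 * IZR m * a \/ phi = - x + 2 * IZR m * a).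
Proof.
  intros Ha. pose proof (archimed (phi / (2 * a))) as [A1 A2].
  set (m := up (phi / (2 * a))) in *.
  assert (B : IZR m * (2 * a) - 2 * a <= phi < IZR m * (2 * a)).
  { assert (E : phi = phi / (2 * a) * (2 * a)) by (field; lra).
    remember (phi / (2 * a)) as y. rewrite E. clear E. split; nra. }
  destruct (Rle_dec (phi - 2 * IZR (m - 1) * a) a) as [C|C]; rewrite minus_IZR in C.
  - exists (m - 1)%Z, (phi - 2 * IZR (m - 1) * a). rewrite minus_IZR. split; [lra|left; ring].
  - exists m, (- phi + 2 * IZR m * a). split; [lra|right; ring].
Qed.

Lemma chord_cdf_of_level (n : nat) (r s v I : R) (B : R -> R) : (0 < n)%nat ->
  RInt.is_RInt B 0 (PI / INR n) I ->
  (forall phi, 0 <= phi <= PI / INR n ->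
     RInt.is_RInt (ind n r s phi) 0 r
       (r * cos phi - Rmax (B phi) 0 + Rmax (- B (antipode n phi)) 0)) ->
  r * sin (PI / INR n) * (1 - v) = I ->
  chord_cdf n r s v.
Proof.
  intros Hn HB HG HI.
  pose proof (PI_div_n n Hn) as Hpi. pose proof (INR_gt0 n Hn) as Hn'.
  assert (Ha : 0 < PI / INR n) by (apply Rdiv_lt_0_compat; [apply PI_RGT_0|assumption]).
  assert (Rot : forall m phi, ind n r s (phi + 2 * IZR m * (PI / INR n)) = ind n r s phi).
  { intros m phi. apply functional_extensionality. intros p. apply ind_ext.
    intros l. apply has_chord_rotate; assumption. }
  assert (Refl : forall phi, ind n r s (- phi) = ind n r s phi).
  { intros phi. apply functional_extensionality. intros p. apply ind_ext.
    intros l. apply has_chord_reflect; assumption. }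
  unfold chord_cdf, perim. set (a := PI / INR n) in *.
  exists (fun phi => RInt (ind n r s phi) 0 r). split.
  - intros phi _. apply is_RInt_of_Coquelicot, (RInt_correct (ind n r s phi)).
    destruct (fold_angle a phi Ha) as (m & x & Hx & [-> | ->]); rewrite Rot, ?Refl;
      eexists; apply HG; assumption.
  - apply is_RInt_of_Coquelicot.
    replace (2 * PI) with (2 * INR n * a) by (rewrite <- Hpi; ring).
    (* The perimeter is [2 * INR n] times [r * sin a], the integral of the support function over one
       sector. *)
    replace (2 * INR n * r * sin a * v) with (2 * INR n * (r * sin a - I))
      by (rewrite <- HI; ring).
    apply is_RInt_even_periodic.
    + intros x. replace (x + 2 * a) with (x + 2 * IZR 1 * a) by ring. rewrite Rot. reflexivity.
    + intros x. rewrite Refl. reflexivity.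
    + destruct (is_RInt_Rmax0 B 0 a I HB) as (J & J1 & J2).
      (* On the sector the antipode is the identity or the reflection, so it preserves the integral
         of the negative part. *)
      assert (J2' : RInt.is_RInt (fun x => Rmax (- B (antipode n x)) 0) 0 a (J - I)).
      { unfold antipode. destruct (Nat.even n); [exact J2|].
        apply (is_RInt_reflect _ _ _ a) in J2.
        replace (a - a) with 0 in J2 by ring. rewrite Rminus_0_r in J2. exact J2. }
      pose proof (is_RInt_scal_cos r a) as C.
      replace (r * sin a - I) with (r * sin a - J + (J - I)) by ring.
      eapply is_RInt_ext;
        [|exact (is_RInt_plus _ _ _ _ _ _ (is_RInt_minus _ _ _ _ _ _ C J1) J2')].
      intros x. rewrite Rmin_left, Rmax_right by lra. intros Hx.
      symmetry. apply is_RInt_unique. apply HG. lra.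
Qed.

(** * The upper level in the fundamental sector *)

Lemma ellE (n : nat) (r : R) (k : nat) : ell n r k = 2 * r * sin (INR k * (PI / INR n)).
Proof. unfold ell, Rdiv. rewrite (Rmult_assoc (INR k)). reflexivity. Qed.

Lemma A1E (n : nat) (r : R) (k : nat) :
  A1 n r k = 2 * r * sin (INR k * (PI / INR n)) * sin ((INR k + 1) * (PI / INR n)).
Proof. unfold A1, Rdiv. rewrite plus_INR, !(Rmult_assoc _ PI). reflexivity. Qed.

Lemma angle_pos (n : nat) : (0 < n)%nat -> 0 < PI / INR n.
Proof. intros H. apply Rdiv_lt_0_compat; [apply PI_RGT_0|apply INR_gt0, H]. Qed.

Lemma angle_le_half (n k : nat) : (0 < n)%nat -> (2 * k <= n)%nat ->
  0 <= INR k * (PI / INR n) <= PI / 2.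
Proof.
  intros Hn Hk. pose proof (angle_pos n Hn). pose proof (PI_div_n n Hn).
  pose proof (pos_INR k). apply le_INR in Hk. rewrite mult_INR in Hk. simpl (INR 2) in Hk. nra.
Qed.

(* Direction, in the fundamental sector [[0, PI/n]], of the lines making the angle [x] with the
   bisector of two edges that are [k+1] apart; for odd [k] this bisector is perpendicular to an
   edge, for even [k] it passes through a vertex. *)
Definition frame (n k : nat) (x : R) : R := if Nat.even k then x else PI / INR n - x.

Lemma frame_involutive (n k : nat) (x : R) : frame n k (frame n k x) = x.
Proof. unfold frame. destruct (Nat.even k); ring. Qed.

Lemma frame_bounds (n k : nat) (x : R) :
  0 <= x <= PI / INR n -> 0 <= frame n k x <= PI / INR n.
Proof. unfold frame. destruct (Nat.even k); lra. Qed.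

Lemma has_chord_frame (n k : nat) (r p x l : R) : (0 < n)%nat ->
  has_chord n r p (frame n k x) l <-> has_chord n r p (x - INR k * (PI / INR n)) l.
Proof.
  intros Hn. unfold frame. set (a := PI / INR n).
  destruct (Nat.even k) eqn:Ek.
  - apply Nat.even_spec in Ek. destruct Ek as (m & ->).
    rewrite <- (has_chord_rotate n r p x l (- Z.of_nat m) Hn). fold a.
    rewrite opp_IZR, <- INR_IZR_INZ, mult_INR. simpl (INR 2).
    replace (x + 2 * - INR m * a) with (x - 2 * INR m * a) by ring. tauto.
  - assert (Ek' : Nat.odd k = true) by (rewrite <- Nat.negb_even, Ek; reflexivity).
    apply Nat.odd_spec in Ek'. destruct Ek' as (m & ->).
    rewrite <- has_chord_reflect by assumption.
    rewrite <- (has_chord_rotate n r p (- (a - x)) l (- Z.of_nat m) Hn). fold a.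
    rewrite opp_IZR, <- INR_IZR_INZ, plus_INR, mult_INR. simpl (INR 2). simpl (INR 1).
    replace (- (a - x) + 2 * - INR m * a) with (x - (2 * INR m + 1) * a) by ring. tauto.
Qed.

Lemma has_chord_frame_succ (n k : nat) (r p x l : R) : (0 < n)%nat ->
  has_chord n r p (frame n k x) l <->
  has_chord n r p (x + (1 - INR (k + 1)) * (PI / INR n)) l.
Proof.
  intros Hn. rewrite has_chord_frame, plus_INR by assumption. simpl (INR 1).
  replace (x + (1 - (INR k + 1)) * (PI / INR n)) with (x - INR k * (PI / INR n)) by ring. tauto.
Qed.

(** Up to symmetry, the bisectors of edges [k] and [k + 1] apart bound the sector. A direction at
    angle [x] from one is therefore at angle [PI / INR n - x] from the other. *)
Lemma has_chord_frame_same (n k : nat) (r p x l : R) : (0 < n)%nat ->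
  has_chord n r p (frame n k x) l <->
  has_chord n r p (PI / INR n - x + (1 - INR k) * (PI / INR n)) l.
Proof.
  intros Hn. rewrite has_chord_frame by assumption.
  rewrite <- has_chord_reflect by assumption.
  rewrite <- (has_chord_rotate n r p _ l (1 - Z.of_nat k) Hn).
  rewrite minus_IZR, <- INR_IZR_INZ.
  replace (- (x - INR k * (PI / INR n)) + 2 * (1 - INR k) * (PI / INR n))
    with (PI / INR n - x + (1 - INR k) * (PI / INR n)) by ring. tauto.
Qed.

(** [A1 n r k] and [A1 n r (k + 1)] are the values of [s] times the sine at which an endpoint of the
    segment reaches a vertex. *)
Lemma is_top_succ (n : nat) (r : R) (k : nat) (s x : R) :
  (2 * (k + 1) < n)%nat -> 0 < r -> 0 <= s -> 0 <= x <= PI / INR n ->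
  A1 n r k <= s * sin ((INR k + 1) * (PI / INR n) - x) ->
  s * sin ((INR k + 1) * (PI / INR n) + x) <= A1 n r (k + 1) ->
  is_top n r (frame n k x) s (level n r s (k + 1) x).
Proof.
  intros Hk Hr Hs Hx H1 H2. rewrite A1E in H1, H2. rewrite plus_INR in H2. simpl (INR 1) in H2.
  split.
  - apply has_chord_frame_succ; [lia|].
    apply level_has_chord; try assumption; try lia; rewrite plus_INR; simpl (INR 1).
    + replace (INR k + 1 - 1) with (INR k) by ring. exact H1.
    + exact H2.
  - intros p Hp. apply has_chord_frame_succ in Hp; [|lia].
    apply has_chord_le_level in Hp; try assumption; lia.
Qed.

(** The assumption on the sine is opposite to that of [is_top_succ], so one of the two pairs always
    qualifies at this end. The condition at the other endpoint follows from [ell n r k <= s]. *)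
Lemma is_top_same (n : nat) (r : R) (k : nat) (s x : R) :
  (0 < k)%nat -> (2 * k < n)%nat -> 0 < r -> 0 <= x <= PI / INR n ->
  ell n r k <= s -> s * sin ((INR k + 1) * (PI / INR n) - x) <= A1 n r k ->
  is_top n r (frame n k x) s (level n r s k (PI / INR n - x)).
Proof.
  intros Hk Hkn Hr Hx Hs H2. rewrite A1E in H2. rewrite ellE in Hs.
  assert (Hn : (0 < n)%nat) by lia.
  pose proof (angle_lt_half n k Hk Hkn) as HQ.
  assert (HaQ : PI / INR n <= INR k * (PI / INR n)).
  { pose proof (angle_pos n Hn). assert (1 <= INR k) by (apply (le_INR 1); lia). nra. }
  assert (SQ : 0 < sin (INR k * (PI / INR n))) by (apply sin_gt_0; lra).
  split.
  - apply has_chord_frame_same; [lia|].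
    apply level_has_chord; try assumption; try lia; try lra; [nra| |].
    + replace (INR k * (PI / INR n) - (PI / INR n - x))
        with ((INR k - 1) * (PI / INR n) + x) by ring.
      assert (M : sin ((INR k - 1) * (PI / INR n)) <= sin ((INR k - 1) * (PI / INR n) + x))
        by (apply sin_incr_1; lra).
      assert (0 <= sin ((INR k - 1) * (PI / INR n))) by (apply sin_ge_0; lra).
      apply Rle_trans with
        (2 * r * sin (INR k * (PI / INR n)) * sin ((INR k - 1) * (PI / INR n))); [lra|].
      apply Rmult_le_compat; nra.
    + replace (INR k * (PI / INR n) + (PI / INR n - x))
        with ((INR k + 1) * (PI / INR n) - x) by ring. exact H2.
  - intros p Hp. apply has_chord_frame_same in Hp; [|lia].
    apply has_chord_le_level in Hp; try assumption; try lia; lra.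
Qed.

Lemma A1_ge0 (n : nat) (r : R) (k : nat) : (0 < n)%nat -> (2 * (k + 1) <= n + 1)%nat ->
  0 < r -> 0 <= A1 n r k.
Proof.
  intros Hn Hk Hr. rewrite A1E. pose proof (angle_le_half n k ltac:(lia) ltac:(lia)).
  pose proof (PI_div_n n ltac:(lia)).
  pose proof (angle_pos n ltac:(lia)). apply le_INR in Hk.
  rewrite mult_INR, !plus_INR in Hk. simpl (INR 2) in Hk. simpl (INR 1) in Hk.
  assert (1 <= INR n) by (apply (le_INR 1); lia).
  assert (0 <= (INR k + 1) * (PI / INR n) <= PI) by (split; nra).
  assert (0 <= sin (INR k * (PI / INR n))) by (apply sin_ge_0; lra).
  assert (0 <= sin ((INR k + 1) * (PI / INR n))) by (apply sin_ge_0; lra).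
  apply Rmult_le_pos; [|assumption]. nra.
Qed.

Lemma A1_0 (n : nat) (r : R) : A1 n r 0 = 0.
Proof. rewrite A1E. simpl. rewrite Rmult_0_l, sin_0. ring. Qed.

(** The support function is the level of length [0] for two adjacent edges, whose lines meet at the
    vertex in direction [0]. *)
Lemma is_top_meets (n : nat) (r x : R) : (3 <= n)%nat -> 0 < r -> 0 <= x <= PI / INR n ->
  is_top n r x 0 (r * cos x).
Proof.
  intros Hn Hr Hx.
  replace (r * cos x) with (level n r 0 (0 + 1) x).
  - apply (is_top_succ n r 0 0 x); try assumption; try lra; try lia.
    + rewrite A1_0. lra.
    + rewrite Rmult_0_l. apply A1_ge0; [lia..|assumption].
  - unfold level. simpl (INR (0 + 1)). rewrite Rmult_1_l.
    pose proof (angle_lt_half n 1 ltac:(lia) ltac:(lia)) as Ha. simpl INR in Ha.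
    rewrite Rmult_1_l in Ha.
    assert (0 < cos (PI / INR n)) by (apply cos_gt_0; lra).
    unfold Rdiv at 4. rewrite Rmult_0_l. field. lra.
Qed.

Lemma antipode_bounds (n : nat) (x : R) :
  0 <= x <= PI / INR n -> 0 <= antipode n x <= PI / INR n.
Proof. unfold antipode. destruct (Nat.even n); lra. Qed.

Lemma antipode_involutive (n : nat) (x : R) : antipode n (antipode n x) = x.
Proof. unfold antipode. destruct (Nat.even n); ring. Qed.

(** The longer chord excludes directions whose longest chord is exactly [s]. Between parallel edges
    such chords fill an interval of values of [p], on which the indicator is [1]. *)
Definition has_top_above (n : nat) (r s phi b : R) : Prop :=
  is_top n r phi s b /\ exists p s', s < s' /\ has_chord n r p phi s'.

Definition all_chords_le (n : nat) (r s phi : R) : Prop :=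
  forall p l, 0 <= l -> has_chord n r p phi l -> l <= s.

Lemma chord_cdf_of_frame (n k : nat) (r s v I : R) (B : R -> R) :
  (3 <= n)%nat -> 0 < r -> 0 <= s ->
  RInt.is_RInt B 0 (PI / INR n) I -> r * sin (PI / INR n) * (1 - v) = I ->
  (forall x, 0 <= x <= PI / INR n ->
     has_top_above n r s (frame n k x) (B x) \/
     (B x = 0 /\ all_chords_le n r s (frame n k x))) ->
  chord_cdf n r s v.
Proof.
  intros Hn Hr Hs HB HI H. assert (Hn0 : (0 < n)%nat) by lia.
  pose proof (angle_lt_half n 1 ltac:(lia) ltac:(lia)) as Ha. simpl INR in Ha.
  rewrite Rmult_1_l in Ha.
  apply (chord_cdf_of_level n r s v I (fun phi => B (frame n k phi))); try assumption.
  { unfold frame. destruct (Nat.even k); [exact HB|].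
    apply (is_RInt_reflect _ _ _ (PI / INR n)) in HB.
    rewrite Rminus_0_r in HB. replace (PI / INR n - PI / INR n) with 0 in HB by ring. exact HB. }
  intros phi Hphi.
  pose proof (antipode_bounds n phi Hphi) as Hphi'.
  pose proof (H _ (frame_bounds n k phi Hphi)) as H1.
  pose proof (H _ (frame_bounds n k _ Hphi')) as H2.
  rewrite frame_involutive in H1, H2.
  assert (Hh : forall y, 0 <= y <= PI / INR n -> 0 <= r * cos y <= r).
  { intros y Hy. assert (0 <= cos y) by (apply cos_ge_0; lra). pose proof (COS_bound y). nra. }
  (* A direction and its antipode have the same chords with [p] negated, so both fall under the same
     alternative. *)
  assert (Anti : forall psi, (exists p s', s < s' /\ has_chord n r p psi s') ->
    all_chords_le n r s (antipode n psi) -> False).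
  { intros psi (p & s' & Hs' & Hc) Hall. specialize (Hall (- p) s' ltac:(lra)).
    rewrite has_chord_antipode, Ropp_involutive in Hall by assumption. specialize (Hall Hc). lra. }
  destruct H1 as [[T1 L1]|[E1 S1]], H2 as [[T2 L2]|[E2 S2]].
  - destruct L1 as (p0 & s' & Hs' & Hc).
    apply (ind_RInt_long n r phi s (r * cos phi) (r * cos (antipode n phi)) _ _ p0 s');
      try assumption; try (apply is_top_meets; assumption); apply Hh; assumption.
  - exfalso. apply (Anti phi L1 S2).
  - exfalso. apply (Anti _ L2). rewrite antipode_involutive. exact S1.
  - rewrite E1, E2, Ropp_0, Rmax_left, Rminus_0_r, Rplus_0_r by lra.
    apply (ind_RInt_short n r phi s (r * cos phi) (r * cos (antipode n phi)));
      try assumption; try (apply is_top_meets; assumption); apply Hh; assumption.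
Qed.

Definition level_integral (n : nat) (r s : R) (q : nat) (psi : R) : R :=
  r * cos (PI / INR n) / cos (INR q * (PI / INR n)) * sin psi
  - s / (2 * sin (2 * (INR q * (PI / INR n))))
    * (sin (2 * psi) / 2 - psi * cos (2 * (INR q * (PI / INR n)))).

Lemma is_RInt_level (n : nat) (r s : R) (q : nat) (u v : R) :
  RInt.is_RInt (level n r s q) u v (level_integral n r s q v - level_integral n r s q u).
Proof.
  unfold level, level_integral.
  set (c1 := _ / _). set (c2 := s / _). set (c3 := cos (2 * (_ * _))).
  apply (is_RInt_derive (fun psi => c1 * sin psi - c2 * (sin (2 * psi) / 2 - psi * c3))).
  - intros x _. auto_derive; [exact Logic.I|]. field.
  - intros x _. apply continuity_pt_filterlim. reg.
Qed.

Lemma is_RInt_level_rev (n : nat) (r s : R) (q : nat) (c u v : R) :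
  RInt.is_RInt (fun x => level n r s q (c - x)) u v
    (level_integral n r s q (c - u) - level_integral n r s q (c - v)).
Proof.
  pose proof (is_RInt_reflect _ _ _ c _ (is_RInt_level n r s q (c - v) (c - u))) as H.
  replace (c - (c - u)) with u in H by ring. replace (c - (c - v)) with v in H by ring.
  exact H.
Qed.

Lemma level_integral_0 (n : nat) (r s : R) (q : nat) : level_integral n r s q 0 = 0.
Proof. unfold level_integral. rewrite Rmult_0_r, sin_0. unfold Rdiv. ring. Qed.

Lemma level_integral_opp (n : nat) (r s : R) (q : nat) (x : R) :
  level_integral n r s q (- x) = - level_integral n r s q x.
Proof.
  unfold level_integral. rewrite <- Ropp_mult_distr_r, !sin_neg. unfold Rdiv. ring.
Qed.

(** At the angle [asin (A / s) - b] the sine term expands into [L2] and [L3], the double angle into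
    [L1], [L2] and [L3], and the linear term into [L4] and the part of [L1] with factor [2 * b]. *)
Lemma hk_level_integral (n : nat) (r : R) (q : nat) (s A b : R) :
  (0 < q)%nat -> (2 * q < n)%nat -> 0 < r -> 0 < s -> 0 <= A <= s ->
  r * sin (PI / INR n) * hk n r q s A b = level_integral n r s q (asin (A / s) - b).
Proof.
  intros Hq Hqn Hr Hs HA.
  pose proof (angle_lt_half n q Hq Hqn) as HQ.
  assert (Hn0 : (0 < n)%nat) by lia.
  pose proof (angle_lt_half n 1 ltac:(lia) ltac:(lia)) as Ha. simpl INR in Ha.
  rewrite Rmult_1_l in Ha.
  assert (Hsg : 0 <= A / s <= 1).
  { split; [apply Rle_mult_inv_pos; lra|]. apply Rmult_le_reg_r with s; [lra|].
    field_simplify; lra. }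
  assert (Sa : sin (asin (A / s)) = A / s) by (apply sin_asin; lra).
  assert (Ca : cos (asin (A / s)) = sqrt (s ^ 2 - A ^ 2) / s).
  { rewrite cos_asin by lra. replace (1 - (A / s)²) with ((s ^ 2 - A ^ 2) / s ^ 2)
      by (unfold Rsqr; field; lra).
    rewrite sqrt_div_alt by nra. f_equal. rewrite <- Rsqr_pow2. apply sqrt_Rsqr. lra. }
  destruct q as [|q']; [lia|]. set (q := S q') in *. cbv beta delta [hk]. fold q.
  unfold q at 1. cbv iota.
  unfold Theta1, Theta2, Theta3, Theta4, L1, L2, L3, L4, csc, sec, cot, level_integral.
  replace (2 * INR q * PI / INR n) with (2 * (INR q * (PI / INR n)))
    by (apply INR_gt0 in Hn0; field; lra).
  replace (INR q * PI / INR n) with (INR q * (PI / INR n))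
    by (apply INR_gt0 in Hn0; field; lra).
  set (a := PI / INR n) in *. remember (INR q * a) as Q.
  set (al := asin (A / s)) in *.
  replace (2 * (al - b)) with (2 * al - 2 * b) by ring.
  rewrite (sin_minus al), (sin_minus (2 * al)), (sin_2a al), (cos_2a_sin al), Ca, Sa.
  assert (0 < sin Q) by (apply sin_gt_0; lra).
  assert (0 < cos Q) by (apply cos_gt_0; lra).
  assert (0 < sin (2 * Q)) by (apply sin_gt_0; lra).
  assert (0 < sin a) by (apply sin_gt_0; lra).
  field. lra.
Qed.

Lemma asin_le_iff (A s y : R) : 0 < s -> 0 <= A <= s -> - (PI / 2) <= y <= PI / 2 ->
  asin (A / s) <= y <-> A <= s * sin y.
Proof.
  intros Hs HA Hy.
  assert (Hsg : 0 <= A / s <= 1).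
  { split; [apply Rle_mult_inv_pos; lra|]. apply Rmult_le_reg_r with s; [lra|].
    field_simplify; lra. }
  pose proof (asin_bound (A / s)) as Ba.
  assert (Sa : A = s * sin (asin (A / s))) by (rewrite sin_asin by lra; field; lra).
  split; intros H.
  - rewrite Sa at 1. apply Rmult_le_compat_l; [lra|]. apply sin_incr_1; lra.
  - destruct (Rle_dec (asin (A / s)) y) as [|C]; [assumption|exfalso].
    assert (sin y < sin (asin (A / s))) by (apply sin_increasing_1; lra). nra.
Qed.

Lemma le_asin_iff (A s y : R) : 0 < s -> 0 <= A <= s -> - (PI / 2) <= y <= PI / 2 ->
  y <= asin (A / s) <-> s * sin y <= A.
Proof.
  intros Hs HA Hy.
  assert (Hsg : 0 <= A / s <= 1).
  { split; [apply Rle_mult_inv_pos; lra|]. apply Rmult_le_reg_r with s; [lra|].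
    field_simplify; lra. }
  pose proof (asin_bound (A / s)) as Ba.
  assert (Sa : A = s * sin (asin (A / s))) by (rewrite sin_asin by lra; field; lra).
  split; intros H.
  - rewrite Sa. apply Rmult_le_compat_l; [lra|]. apply sin_incr_1; lra.
  - destruct (Rle_dec y (asin (A / s))) as [|C]; [assumption|exfalso].
    assert (sin (asin (A / s)) < sin y) by (apply sin_increasing_1; lra). nra.
Qed.

(** * Integrals of the level *)

Definition top (n : nat) (r : R) (k : nat) (s x : R) : R :=
  if Rle_dec (A1 n r k) (s * sin ((INR k + 1) * (PI / INR n) - x))
  then level n r s (k + 1) x else level n r s k (PI / INR n - x).

Lemma is_top_top (n : nat) (r : R) (k : nat) (s x : R) :
  (2 * (k + 1) < n)%nat -> 0 < r -> 0 <= s -> 0 <= x <= PI / INR n -> ell n r k <= s ->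
  s * sin ((INR k + 1) * (PI / INR n) + x) <= A1 n r (k + 1) ->
  is_top n r (frame n k x) s (top n r k s x).
Proof.
  intros Hk Hr Hs Hx Hell H. unfold top.
  destruct Rle_dec as [C|C].
  - apply is_top_succ; assumption.
  - destruct k as [|k].
    (* There is no pair of edges [0] apart: [A1 n r 0 = 0] forces the first branch. *)
    + exfalso. apply C. rewrite A1_0. simpl. rewrite Rplus_0_l, Rmult_1_l.
      pose proof (angle_le_half n 1 ltac:(lia) ltac:(lia)) as Ha. simpl in Ha.
      apply Rmult_le_pos; [lra|]. apply sin_ge_0; lra.
    + apply is_top_same; try assumption; try lia; lra.
Qed.

Definition split_angle (n : nat) (r : R) (k : nat) (s : R) : R :=
  (INR k + 1) * (PI / INR n) - asin (A1 n r k / s).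

Section SplitAngle.
Context (n : nat) (r : R) (k : nat) (s : R).
Hypotheses (Hk : (2 * (k + 1) <= n)%nat) (Hr : 0 < r) (Hs : 0 < s).
Hypothesis (Hell : ell n r k <= s).

Lemma A1_bounds : 0 <= A1 n r k <= s.
Proof.
  split; [apply A1_ge0; [lia..|assumption]|].
  rewrite A1E. rewrite ellE in Hell.
  pose proof (angle_le_half n k ltac:(lia) ltac:(lia)).
  assert (0 <= sin (INR k * (PI / INR n))) by (apply sin_ge_0; lra).
  pose proof (SIN_bound ((INR k + 1) * (PI / INR n))).
  apply Rle_trans with (2 * r * sin (INR k * (PI / INR n)) * 1); [|lra].
  apply Rmult_le_compat_l; nra.
Qed.

Lemma succ_angle_bounds : 0 <= (INR k + 1) * (PI / INR n) <= PI / 2.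
Proof.
  replace (INR k + 1) with (INR (k + 1)) by (rewrite plus_INR; reflexivity).
  apply angle_le_half; lia.
Qed.

(** The bound [ell n r k <= s] puts the split angle to the right of [0]; the bound
    [s <= ell n r (k + 1)] keeps it below [PI / INR n] in the next lemma. *)
Lemma split_angle_ge0 : 0 <= split_angle n r k s.
Proof.
  unfold split_angle. pose proof A1_bounds. pose proof succ_angle_bounds.
  assert (asin (A1 n r k / s) <= (INR k + 1) * (PI / INR n)); [|lra].
  apply asin_le_iff; [assumption..|lra|]. rewrite A1E. rewrite ellE in Hell.
  apply Rmult_le_compat_r; [|assumption]. apply sin_ge_0; lra.
Qed.

Lemma split_angle_le : s <= ell n r (k + 1) -> split_angle n r k s <= PI / INR n.
Proof.
  intros Hell'. unfold split_angle. pose proof A1_bounds.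
  pose proof (angle_le_half n k ltac:(lia) ltac:(lia)).
  assert (INR k * (PI / INR n) <= asin (A1 n r k / s)); [|lra].
  apply le_asin_iff; [assumption..|lra|]. rewrite A1E. rewrite ellE, plus_INR in Hell'.
  simpl (INR 1) in Hell'.
  assert (0 <= sin (INR k * (PI / INR n))) by (apply sin_ge_0; lra). nra.
Qed.

Lemma le_split_angle (x : R) : 0 <= x <= PI / INR n ->
  x <= split_angle n r k s <-> A1 n r k <= s * sin ((INR k + 1) * (PI / INR n) - x).
Proof.
  intros Hx. pose proof A1_bounds. pose proof succ_angle_bounds.
  assert (PI / INR n <= (INR k + 1) * (PI / INR n)).
  { pose proof (angle_pos n ltac:(lia)). pose proof (pos_INR k). nra. }
  rewrite <- asin_le_iff by (assumption || lra). unfold split_angle. lra.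
Qed.

Lemma is_RInt_top_low (u v : R) : 0 <= u <= v -> v <= split_angle n r k s -> v <= PI / INR n ->
  RInt.is_RInt (top n r k s) u v
    (level_integral n r s (k + 1) v - level_integral n r s (k + 1) u).
Proof.
  intros Hu Hv Hv'. eapply is_RInt_ext; [|apply is_RInt_level].
  intros x. rewrite Rmin_left, Rmax_right by lra. intros Hx. unfold top.
  destruct Rle_dec as [_|C]; [reflexivity|].
  exfalso. apply C, le_split_angle; lra.
Qed.

Lemma is_RInt_top_high (u : R) : 0 <= u -> split_angle n r k s <= u <= PI / INR n ->
  RInt.is_RInt (top n r k s) u (PI / INR n) (level_integral n r s k (PI / INR n - u)).
Proof.
  intros Hu Hu'.
  pose proof (is_RInt_level_rev n r s k (PI / INR n) u (PI / INR n)) as H.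
  replace (PI / INR n - PI / INR n) with 0 in H by ring.
  rewrite level_integral_0, Rminus_0_r in H.
  eapply is_RInt_ext; [|exact H].
  intros x. rewrite Rmin_left, Rmax_right by lra. intros Hx. unfold top.
  destruct Rle_dec as [C|_]; [|reflexivity].
  exfalso. apply le_split_angle in C; lra.
Qed.

Lemma hk_split_angle : (2 * k < n)%nat ->
  r * sin (PI / INR n) * hk n r k s (A1 n r k) (B1 n k)
  = level_integral n r s k (PI / INR n - split_angle n r k s).
Proof.
  intros Hkn.
  replace (PI / INR n - split_angle n r k s) with (asin (A1 n r k / s) - B1 n k)
    by (unfold split_angle, B1, Rdiv; ring).
  (* The value [0] of [hk] at [k = 0] fits: the split angle is then [PI / INR n], which leaves no
     room for the pair [k]. *)
  destruct (Nat.eq_dec k 0) as [E|E].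
  - rewrite E, A1_0. replace (asin (0 / s) - B1 n 0) with 0.
    + rewrite level_integral_0. simpl. ring.
    + unfold B1, Rdiv. rewrite Rmult_0_l, asin_0. simpl. ring.
  - apply hk_level_integral; try assumption; try lia. apply A1_bounds.
Qed.

Lemma hk_succ_split_angle : (2 * (k + 1) < n)%nat ->
  r * sin (PI / INR n) * hk n r (k + 1) s (A1 n r k) (B1 n k + PI / INR n)
  = - level_integral n r s (k + 1) (split_angle n r k s).
Proof.
  intros Hkn. rewrite <- level_integral_opp.
  replace (- split_angle n r k s) with (asin (A1 n r k / s) - (B1 n k + PI / INR n))
    by (unfold split_angle, B1, Rdiv; ring).
  apply hk_level_integral; try assumption; try lia. apply A1_bounds.
Qed.

(** The length [s'] serves twice: its endpoint condition implies the one for [s], and it supplies a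
    longer chord in every direction. *)
Lemma chord_cdf_two_pairs : (3 <= n)%nat -> (2 * (k + 1) < n)%nat -> s <= ell n r (k + 1) ->
  (exists s', s < s' /\ forall x, 0 <= x <= PI / INR n ->
     s' * sin ((INR k + 1) * (PI / INR n) + x) <= A1 n r (k + 1)) ->
  chord_cdf n r s (1 - hk n r k s (A1 n r k) (B1 n k)
                   + hk n r (k + 1) s (A1 n r k) (B1 n k + PI / INR n)).
Proof.
  intros Hn Hkn Hell' (s' & Hs' & HA).
  pose proof split_angle_ge0. pose proof (split_angle_le Hell').
  apply (chord_cdf_of_frame n k r s _
     (level_integral n r s (k + 1) (split_angle n r k s)
      + level_integral n r s k (PI / INR n - split_angle n r k s)) (top n r k s));
    try assumption; try lra.
  - apply is_RInt_concat with (split_angle n r k s).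
    + pose proof (is_RInt_top_low 0 (split_angle n r k s) ltac:(lra) ltac:(lra) ltac:(lra)) as L.
      rewrite level_integral_0, Rminus_0_r in L. exact L.
    + apply is_RInt_top_high; lra.
  - rewrite <- hk_split_angle by lia.
    replace (level_integral n r s (k + 1) (split_angle n r k s))
      with (- (r * sin (PI / INR n) * hk n r (k + 1) s (A1 n r k) (B1 n k + PI / INR n)))
      by (rewrite hk_succ_split_angle by assumption; ring).
    ring.
  - intros x Hx. left.
    assert (Hpos : 0 <= sin ((INR k + 1) * (PI / INR n) + x)).
    { pose proof succ_angle_bounds.
      pose proof (angle_lt_half n 1 ltac:(lia) ltac:(lia)) as Ha. simpl INR in Ha.
      apply sin_ge_0; lra. }
    specialize (HA x Hx). split.
    + apply is_top_top; try assumption; try lra. nra.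
    + exists (top n r k s' x), s'. split; [assumption|]. apply is_top_top; try assumption; lra.
Qed.

End SplitAngle.

(** * Directions without chords longer than [s] *)

Lemma cos_pos_sector (n : nat) (x : R) : (3 <= n)%nat -> 0 <= x <= PI / INR n -> 0 < cos x.
Proof.
  intros Hn Hx. pose proof (angle_lt_half n 1 ltac:(lia) ltac:(lia)) as Ha. simpl INR in Ha.
  apply cos_gt_0; lra.
Qed.

(* For even [n] the edges [n/2] apart are parallel, which bounds all chords of a direction. *)
Lemma all_chords_le_even (n : nat) (r : R) (k : nat) (s x : R) :
  (3 <= n)%nat -> n = (2 * (k + 1))%nat -> 0 < r -> 0 <= x <= PI / INR n ->
  A1 n r k <= s * sin ((INR k + 1) * (PI / INR n) - x) ->
  all_chords_le n r s (frame n k x).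
Proof.
  intros Hn En Hr Hx H p l Hl Hc.
  apply has_chord_frame_succ in Hc; [|lia].
  apply has_chord_edge_pair in Hc; [|lia..|assumption].
  pose proof (PI_div_n n ltac:(lia)) as Hpi.
  assert (HQ : (INR k + 1) * (PI / INR n) = PI / 2).
  { rewrite En, mult_INR, plus_INR in Hpi at 1. simpl (INR 2) in Hpi. simpl (INR 1) in Hpi. lra. }
  rewrite plus_INR in Hc. simpl (INR 1) in Hc. rewrite A1E in H.
  replace (INR k * (PI / INR n)) with (PI / 2 - PI / INR n) in H by (rewrite <- HQ; ring).
  rewrite HQ in *. replace (2 * (PI / 2)) with PI in Hc by field.
  replace (sin (PI / 2 + x)) with (cos x) in Hc by (rewrite sin_plus, sin_PI2, cos_PI2; ring).
  rewrite !sin_shift, sin_PI2 in H. rewrite sin_shift, sin_PI, sin_PI2 in Hc.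
  pose proof (cos_pos_sector n x Hn Hx). apply Rmult_le_reg_r with (cos x * cos x); nra.
Qed.

Lemma odd_last_angle (n k : nat) : n = (2 * (k + 1) + 1)%nat ->
  (INR k + 1) * (PI / INR n) = PI / 2 - PI / INR n / 2.
Proof.
  intros En. pose proof (PI_div_n n ltac:(lia)) as Hpi.
  rewrite En, !plus_INR, mult_INR, plus_INR in Hpi at 1.
  simpl (INR 2) in Hpi. simpl (INR 1) in Hpi. lra.
Qed.

(** The angles in [A1 n r (k + 1)] are symmetric about [PI / 2]. This is the origin of [A2] and
    [lam]: they are the next critical value after [A1 n r k]. *)
Lemma A1_odd (n : nat) (r : R) (k : nat) : n = (2 * (k + 1) + 1)%nat ->
  A1 n r (k + 1) = 2 * r * cos (PI / INR n / 2) ^ 2.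
Proof.
  intros En. rewrite A1E, plus_INR. simpl (INR 1).
  replace ((INR k + 1 + 1) * (PI / INR n)) with (PI / 2 + PI / INR n / 2)
    by (pose proof (odd_last_angle n k En); lra).
  rewrite (odd_last_angle n k En), sin_shift, sin_plus, sin_PI2, cos_PI2. ring.
Qed.

(* For odd [n] the largest chord of a direction starts at a vertex; when it is too short, the
   bounds on [p] and [-p] given by [has_chord_le_level] are incompatible. *)
Lemma all_chords_le_odd (n : nat) (r : R) (k : nat) (s x : R) :
  n = (2 * (k + 1) + 1)%nat -> 0 < r -> 0 <= x <= PI / INR n ->
  A1 n r (k + 1) <= s * sin ((INR k + 1) * (PI / INR n) + x) ->
  all_chords_le n r s (frame n k x).
Proof.
  intros En Hr Hx H p l Hl Hc.
  assert (Hc' : has_chord n r (- p) (frame n k (PI / INR n - x)) l).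
  { replace (frame n k (PI / INR n - x)) with (antipode n (frame n k x)).
    - apply has_chord_antipode; [lia|]. rewrite Ropp_involutive. exact Hc.
    - unfold antipode, frame. replace (Nat.even n) with false; [destruct (Nat.even k); ring|].
      symmetry. rewrite En, Nat.even_add, Nat.even_mul. reflexivity. }
  apply has_chord_frame_succ in Hc, Hc'; [|lia..].
  apply has_chord_le_level in Hc, Hc'; [|lia || lra..].
  rewrite (A1_odd n r k En) in H. unfold level in Hc, Hc'.
  rewrite plus_INR in Hc, Hc'. simpl (INR 1) in Hc, Hc'.
  rewrite (odd_last_angle n k En) in H, Hc, Hc'.
  pose proof (angle_lt_half n 1 ltac:(lia) ltac:(lia)) as Ha. simpl INR in Ha.
  rewrite Rmult_1_l in Ha.
  remember (PI / INR n / 2) as e. replace (PI / INR n) with (2 * e) in * by lra.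
  (* Centring the sector turns the antipode into [y] to [- y]. *)
  set (y := x - e). replace x with (e + y) in * by (unfold y; ring).
  assert (Hy : - e <= y <= e) by lra. clearbody y.
  assert (Cy : 0 < cos y) by (apply cos_gt_0; lra).
  assert (Ce : 0 < cos e) by (apply cos_gt_0; lra).
  assert (Se : 0 < sin e) by (apply sin_gt_0; lra).
  assert (C2e : 0 < cos (2 * e)) by (apply cos_gt_0; lra).
  replace (2 * (PI / 2 - e)) with (PI - 2 * e) in Hc, Hc' by field.
  replace (PI / 2 - e + (e + y)) with (PI / 2 + y) in H by ring.
  rewrite sin_plus, sin_PI2, cos_PI2 in H.
  rewrite cos_shift, sin_PI_x, (cos_minus PI), sin_PI, cos_PI in Hc, Hc'.
  rewrite (sin_2a e) in Hc, Hc'.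
  replace (2 * e - (e + y)) with (e - y) in Hc' by ring.
  replace (2 * (e + y)) with (2 * e + 2 * y) in Hc by ring.
  replace (2 * (e - y)) with (2 * e - 2 * y) in Hc' by ring.
  rewrite !cos_plus in Hc. rewrite !cos_minus in Hc'.
  rewrite (cos_2a_cos y) in Hc, Hc'.
  destruct (Rle_dec l s) as [|C]; [assumption|exfalso].
  assert (Hsum : 0 <= 2 * r * cos (2 * e) * cos e * cos y / sin e
                    - l * cos (2 * e) * (cos y * cos y) / (sin e * cos e)).
  { apply Rle_trans with (- p + p); [lra|].
    eapply Rle_trans; [exact (Rplus_le_compat _ _ _ _ Hc' Hc)|].
    apply Req_le. field. lra. }
  assert (Hprod : 0 <= cos (2 * e) * cos y * (2 * r * cos e ^ 2 - l * cos y)).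
  { apply Rmult_le_reg_r with (/ (sin e * cos e)).
    - apply Rinv_0_lt_compat. nra.
    - rewrite Rmult_0_l. eapply Rle_trans; [exact Hsum|]. apply Req_le. field. lra. }
  assert (0 < cos (2 * e) * cos y) by (apply Rmult_lt_0_compat; assumption).
  assert (s * cos y < l * cos y) by (apply Rmult_lt_compat_r; lra).
  apply (Rmult_le_compat_l (/ (cos (2 * e) * cos y))) in Hprod;
    [|apply Rlt_le, Rinv_0_lt_compat; assumption].
  rewrite <- Rmult_assoc, Rinv_l, Rmult_0_r, Rmult_1_l in Hprod by lra. lra.
Qed.

(** * The distribution function on the extreme ranges of [s] *)

Lemma is_RInt_zero (a b : R) : RInt.is_RInt (fun _ => 0) a b 0.
Proof.
  pose proof (is_RInt_const a b 0) as H. change (scal (b - a) 0) with ((b - a) * 0) in H.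
  rewrite Rmult_0_r in H. exact H.
Qed.

Lemma chord_cdf_one (n : nat) (r : R) (k : nat) (s : R) : (3 <= n)%nat -> 0 < r -> 0 <= s ->
  (forall x, 0 <= x <= PI / INR n -> all_chords_le n r s (frame n k x)) ->
  chord_cdf n r s 1.
Proof.
  intros Hn Hr Hs H. apply (chord_cdf_of_frame n k r s 1 0 (fun _ => 0)); auto.
  - apply is_RInt_zero.
  - ring.
Qed.

Lemma chord_cdf_nonpos (n : nat) (r s : R) : (3 <= n)%nat -> 0 < r -> s <= 0 ->
  chord_cdf n r s 0.
Proof.
  intros Hn Hr [Hs | ->].
  - exists (fun _ => 0). rewrite Rmult_0_r. split; [intros phi _|]; apply is_RInt_of_Coquelicot.
    + eapply is_RInt_ext; [|apply is_RInt_zero]. intros p _. symmetry.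
      apply ind_zero with 0; auto; lra.
    + apply is_RInt_zero.
  (* At [s = 0] the level is the support function, so its integral accounts for all lines that meet
     the polygon. *)
  - apply (chord_cdf_of_frame n 0 r 0 0 (r * sin (PI / INR n)) (fun x => r * cos x));
      try assumption; try lra; try ring.
    + apply is_RInt_scal_cos.
    + intros x Hx. left. split; [apply is_top_meets; assumption|].
      assert (HA : 0 < A1 n r 1).
      { rewrite A1E. pose proof (angle_lt_half n 1 ltac:(lia) ltac:(lia)) as Ha.
        simpl INR in *.
        assert (0 < sin (1 * (PI / INR n))) by (apply sin_gt_0; lra).
        assert (0 < sin ((1 + 1) * (PI / INR n))) by (apply sin_gt_0; lra).
        apply Rmult_lt_0_compat; nra. }
      exists (top n r 0 (A1 n r 1) x), (A1 n r 1). split; [assumption|].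
      apply is_top_top; try assumption; try lia; try lra.
      * rewrite ellE. simpl. rewrite Rmult_0_l, sin_0. lra.
      * pose proof (SIN_bound ((INR 0 + 1) * (PI / INR n) + x)). simpl (0 + 1)%nat. nra.
Qed.

(** Edges [k + 1] apart are now parallel. Where they would decide, up to the split angle, no chord
    is longer than [s], so only the term of the pair [k] survives. *)
Lemma chord_cdf_even_last (n : nat) (r : R) (k : nat) (s : R) :
  (3 <= n)%nat -> n = (2 * (k + 1))%nat -> 0 < r -> 0 < s -> ell n r k <= s <= ell n r (k + 1) ->
  chord_cdf n r s (1 - hk n r k s (A1 n r k) (B1 n k)).
Proof.
  intros Hn En Hr Hs Hell.
  pose proof (split_angle_ge0 n r k s ltac:(lia) Hr Hs ltac:(lra)) as X0.
  pose proof (split_angle_le n r k s ltac:(lia) Hr Hs ltac:(lra) ltac:(lra)) as X1.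
  pose (B x := if Rle_dec (A1 n r k) (s * sin ((INR k + 1) * (PI / INR n) - x))
               then 0 else level n r s k (PI / INR n - x)).
  apply (chord_cdf_of_frame n k r s _
     (0 + level_integral n r s k (PI / INR n - split_angle n r k s)) B);
    try assumption; try lra.
  - apply is_RInt_concat with (split_angle n r k s).
    + eapply is_RInt_ext; [|apply is_RInt_zero].
      intros x. rewrite Rmin_left, Rmax_right by lra. intros Hx. unfold B.
      destruct Rle_dec as [_|C]; [reflexivity|].
      exfalso. apply C, le_split_angle; try assumption; try lia; lra.
    + eapply is_RInt_ext; [|apply is_RInt_top_high; try assumption; try lia; lra].
      intros x. rewrite Rmin_left, Rmax_right by lra. intros Hx. unfold B, top.
      destruct Rle_dec as [C|_]; [|reflexivity].
      exfalso. apply le_split_angle in C; try assumption; try lia; lra.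
  - rewrite <- hk_split_angle by (try assumption; try lia; lra). ring.
  - intros x Hx. unfold B. destruct Rle_dec as [C|C].
    + right. split; [reflexivity|]. apply all_chords_le_even; assumption.
    + left. apply Rnot_le_lt in C.
      assert (Sx : 0 < sin ((INR k + 1) * (PI / INR n) - x)).
      { pose proof (succ_angle_bounds n k ltac:(lia)).
        assert (1 <= INR k) by (apply (le_INR 1); lia).
        pose proof (angle_pos n ltac:(lia)). apply sin_gt_0; nra. }
      split; [apply is_top_same; try assumption; try lia; lra|].
      (* The length for which an endpoint reaches a vertex; it exceeds [s] by [C]. *)
      set (s' := A1 n r k / sin ((INR k + 1) * (PI / INR n) - x)).
      assert (Hs' : s' * sin ((INR k + 1) * (PI / INR n) - x) = A1 n r k)
        by (unfold s'; field; lra).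
      assert (s < s') by nra.
      exists (level n r s' k (PI / INR n - x)), s'. split; [assumption|].
      apply is_top_same; try assumption; try lia; lra.
Qed.

Lemma lam_half (n : nat) (r : R) : (0 < n)%nat -> lam n r = 2 * r * cos (PI / INR n / 2) ^ 2.
Proof.
  intros Hn. unfold lam. apply INR_gt0 in Hn.
  replace (PI / (2 * INR n)) with (PI / INR n / 2) by (field; lra). reflexivity.
Qed.

Lemma B2_half (n : nat) : (0 < n)%nat -> B2 n = PI / 2 - PI / INR n / 2.
Proof. intros Hn. unfold B2. apply INR_gt0 in Hn. field; lra. Qed.

(** The directions without longer chords form an interval [[x1, x2]] centred at half of [PI / INR n]
    and contained in the range of the pair [k + 1]. Removing it from the integral produces the two
    terms with [A2], one for each end. *)
Lemma chord_cdf_odd_last (n : nat) (r : R) (k : nat) (s : R) :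
  n = (2 * (k + 1) + 1)%nat -> 0 < r -> 0 < s ->
  ell n r k <= s <= ell n r (k + 1) -> lam n r <= s ->
  chord_cdf n r s (1 - hk n r k s (A1 n r k) (B1 n k)
                   + hk n r (k + 1) s (A1 n r k) (B1 n k + PI / INR n)
                   - hk n r (k + 1) s (A2 n r) (B2 n + PI / INR n)
                   - hk n r (k + 1) s (A2 n r) (B2 n)).
Proof.
  intros En Hr Hs Hell Hlam.
  pose proof (split_angle_ge0 n r k s ltac:(lia) Hr Hs ltac:(lra)) as X0.
  pose proof (split_angle_le n r k s ltac:(lia) Hr Hs ltac:(lra) ltac:(lra)) as X1.
  pose proof (odd_last_angle n k En) as HM.
  pose proof (angle_lt_half n 1 ltac:(lia) ltac:(lia)) as Ha. simpl INR in Ha.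
  rewrite Rmult_1_l in Ha.
  assert (E2 : A2 n r = A1 n r (k + 1)).
  { rewrite (A1_odd n r k En). apply lam_half; lia. }
  assert (HA : 0 <= A1 n r (k + 1) <= s).
  { split; [apply A1_ge0; [lia..|assumption]|]. rewrite <- E2. exact Hlam. }
  set (al := asin (A1 n r (k + 1) / s)).
  pose proof (asin_bound (A1 n r (k + 1) / s)) as Bal. fold al in Bal.
  assert (HalM : (INR k + 1) * (PI / INR n) <= al).
  { apply le_asin_iff; [lra|assumption|lra|].
    rewrite (A1_odd n r k En), HM, sin_shift.
    destruct Hell as [_ Hell]. rewrite ellE, plus_INR in Hell. simpl (INR 1) in Hell.
    rewrite HM, sin_shift in Hell.
    assert (0 < cos (PI / INR n / 2)) by (apply cos_gt_0; lra). nra. }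
  set (x1 := al - (INR k + 1) * (PI / INR n)).
  set (x2 := (INR k + 1) * (PI / INR n) + PI / INR n - al).
  assert (H12 : x1 <= PI / INR n / 2 <= x2) by (unfold x1, x2; lra).
  (* Amounts to [A1 n r k <= s * sin (al - PI / INR n)]. Expand the sine: [s * sin al] is
     [A1 n r (k + 1)], and [s * cos al] is bounded through [s <= ell n r (k + 1)] and [HalM];
     equality holds at [s = ell n r (k + 1)]. *)
  assert (H2s : x2 <= split_angle n r k s).
  { unfold x2, split_angle. assert (asin (A1 n r k / s) <= al - PI / INR n); [|lra].
    pose proof (A1_bounds n r k s ltac:(lia) Hr ltac:(lra)).
    apply asin_le_iff; [assumption..|lra|].
    assert (Sal : s * sin al = A1 n r (k + 1)) by (unfold al; rewrite sin_asin; [field; lra|];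
      split; [apply Rle_trans with 0; [lra|]; apply Rle_mult_inv_pos; lra|];
      apply Rmult_le_reg_r with s; [lra|]; field_simplify; lra).
    rewrite sin_minus, Rmult_minus_distr_l, <- !Rmult_assoc, Sal, A1E.
    replace (INR k * (PI / INR n)) with ((INR k + 1) * (PI / INR n) - PI / INR n) by ring.
    rewrite (A1_odd n r k En).
    destruct Hell as [_ Hell]. rewrite ellE, plus_INR in Hell. simpl (INR 1) in Hell.
    assert (Cal : 0 <= cos al <= cos ((INR k + 1) * (PI / INR n))).
    { split; [apply cos_ge_0; lra|]. apply cos_decr_1; lra. }
    rewrite sin_minus.
    replace (cos (PI / INR n / 2)) with (sin ((INR k + 1) * (PI / INR n)))
      by (rewrite HM; apply sin_shift).
    assert (0 <= sin (PI / INR n)) by (apply sin_ge_0; lra).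
    assert (s * cos al <= 2 * r * sin ((INR k + 1) * (PI / INR n))
                          * cos ((INR k + 1) * (PI / INR n)))
      by (apply Rmult_le_compat; lra).
    nra. }
  assert (Hcond : forall x, 0 <= x <= PI / INR n ->
    A1 n r (k + 1) <= s * sin ((INR k + 1) * (PI / INR n) + x) <-> x1 <= x <= x2).
  { intros x Hx. unfold x1, x2.
    destruct (Rle_dec x (PI / INR n / 2)).
    - rewrite <- asin_le_iff by lra. fold al. lra.
    (* On this half the angle exceeds [PI / 2], beyond the range of [asin]; its supplement is used
       instead. *)
    - rewrite <- sin_PI_x, <- asin_le_iff by lra. fold al. lra. }
  pose (B x := if Rle_dec (A1 n r (k + 1)) (s * sin ((INR k + 1) * (PI / INR n) + x))
               then 0 else top n r k s x).
  set (P := level_integral n r s (k + 1)).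
  apply (chord_cdf_of_frame n k r s _
     (P x1 - P 0 + 0 + (P (split_angle n r k s) - P x2)
      + level_integral n r s k (PI / INR n - split_angle n r k s)) B);
    try assumption; try lia; try lra.
  - assert (x1 >= 0) by (unfold x1; lra).
    apply is_RInt_concat with (split_angle n r k s);
      [apply is_RInt_concat with x2; [apply is_RInt_concat with x1|]|].
    + eapply is_RInt_ext; [|apply (is_RInt_top_low n r k s); try assumption; try lia; lra].
      intros x. rewrite Rmin_left, Rmax_right by lra. intros Hx. unfold B.
      destruct Rle_dec as [C|_]; [|reflexivity]. apply Hcond in C; lra.
    + eapply is_RInt_ext; [|apply is_RInt_zero].
      intros x. rewrite Rmin_left, Rmax_right by lra. intros Hx. unfold B.
      destruct Rle_dec as [_|C]; [reflexivity|]. exfalso. apply C, Hcond; lra.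
    + eapply is_RInt_ext; [|apply (is_RInt_top_low n r k s); try assumption; try lia; lra].
      intros x. rewrite Rmin_left, Rmax_right by lra. intros Hx. unfold B.
      destruct Rle_dec as [C|_]; [|reflexivity]. apply Hcond in C; lra.
    + eapply is_RInt_ext; [|apply (is_RInt_top_high n r k s); try assumption; try lia; lra].
      intros x. rewrite Rmin_left, Rmax_right by lra. intros Hx. unfold B.
      destruct Rle_dec as [C|_]; [|reflexivity]. apply Hcond in C; lra.
  - rewrite <- hk_split_angle by (try assumption; try lia; lra).
    assert (R1 : P (split_angle n r k s)
      = - (r * sin (PI / INR n) * hk n r (k + 1) s (A1 n r k) (B1 n k + PI / INR n)))
      by (rewrite hk_succ_split_angle by (try assumption; try lia; lra); unfold P; ring).
    assert (R2 : P x2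
      = - (r * sin (PI / INR n) * hk n r (k + 1) s (A2 n r) (B2 n + PI / INR n))).
    { rewrite hk_level_integral by (try assumption; try lia; rewrite ?E2; lra).
      rewrite E2, B2_half, <- HM by lia. fold al. fold P. unfold P at 2.
      rewrite <- level_integral_opp. unfold P, x2. f_equal. ring. }
    assert (R3 : P x1 = r * sin (PI / INR n) * hk n r (k + 1) s (A2 n r) (B2 n)).
    { rewrite hk_level_integral by (try assumption; try lia; rewrite ?E2; lra).
      rewrite E2, B2_half, <- HM by lia. reflexivity. }
    rewrite R1, R2, R3. unfold P. rewrite level_integral_0. ring.
  - intros x Hx. unfold B. destruct Rle_dec as [C|C].
    + right. split; [reflexivity|]. apply all_chords_le_odd; assumption.
    + left. apply Rnot_le_lt in C.
      assert (Sx : 0 < sin ((INR k + 1) * (PI / INR n) + x)) by (apply sin_gt_0; lra).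
      split; [apply is_top_top; try assumption; try lia; lra|].
      set (s' := A1 n r (k + 1) / sin ((INR k + 1) * (PI / INR n) + x)).
      assert (Hs' : s' * sin ((INR k + 1) * (PI / INR n) + x) = A1 n r (k + 1))
        by (unfold s'; field; lra).
      assert (s < s') by nra.
      exists (top n r k s' x), s'. split; [assumption|].
      apply is_top_top; try assumption; try lia; lra.
Qed.

(** * Parity of [n] and the ranges of [s] *)

Lemma Kn_even (n : nat) : (3 <= n)%nat -> Nat.even n = true -> n = (2 * (Kn n + 1))%nat.
Proof.
  intros Hn En. apply Nat.even_spec in En. destruct En as (m & ->). unfold Kn.
  replace (2 * m - 2)%nat with ((m - 1) * 2)%nat by lia. rewrite Nat.div_mul; lia.
Qed.

Lemma Kn_odd (n : nat) : (3 <= n)%nat -> Nat.even n = false -> n = (2 * (Kn n + 1) + 1)%nat.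
Proof.
  intros Hn En. assert (En' : Nat.odd n = true) by (rewrite <- Nat.negb_even, En; reflexivity).
  apply Nat.odd_spec in En'. destruct En' as (m & ->). unfold Kn.
  replace (2 * m + 1 - 2)%nat with (1 + (m - 1) * 2)%nat by lia.
  rewrite Nat.div_add by lia. simpl (1 / 2)%nat. lia.
Qed.

Lemma ell_mono (n : nat) (r : R) (j k : nat) : (0 < n)%nat -> 0 < r -> (j <= k)%nat ->
  (2 * k <= n)%nat -> ell n r j <= ell n r k.
Proof.
  intros Hn Hr Hjk Hk. rewrite !ellE. pose proof (angle_pos n Hn).
  pose proof (angle_le_half n k Hn Hk). pose proof (angle_le_half n j Hn ltac:(lia)).
  apply le_INR in Hjk. apply Rmult_le_compat_l; [lra|].
  apply sin_incr_1; try lra. apply Rmult_le_compat_r; lra.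
Qed.

(** [ell n r (Kn n + 1)] is the diameter of the polygon, so the criterion for having no longer chord
    holds in every direction. *)
Lemma chord_cdf_full (n : nat) (r s : R) : (3 <= n)%nat -> 0 < r ->
  ell n r (Kn n + 1) <= s -> chord_cdf n r s 1.
Proof.
  intros Hn Hr Hs. rewrite ellE, plus_INR in Hs. simpl (INR 1) in Hs.
  pose proof (angle_lt_half n 1 ltac:(lia) ltac:(lia)) as Ha. simpl (INR 1) in Ha.
  rewrite Rmult_1_l in Ha. pose proof (PI_div_n n ltac:(lia)) as Hpi.
  destruct (Nat.even n) eqn:En.
  - apply Kn_even in En; [|assumption]. set (k := Kn n) in *.
    assert (HQ : (INR k + 1) * (PI / INR n) = PI / 2).
    { rewrite En, mult_INR, plus_INR in Hpi at 1. simpl (INR 2) in Hpi. simpl (INR 1) in Hpi. lra. }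
    rewrite HQ, sin_PI2 in Hs.
    apply (chord_cdf_one n r k); try assumption; try lra. intros x Hx.
    apply all_chords_le_even; try assumption. rewrite A1E.
    replace (INR k * (PI / INR n)) with (PI / 2 - PI / INR n) by (rewrite <- HQ; ring).
    rewrite HQ, !sin_shift, sin_PI2.
    assert (0 <= cos (PI / INR n) <= cos x).
    { split; [apply cos_ge_0; lra|apply cos_decr_1; lra]. }
    rewrite Rmult_1_r. apply Rmult_le_compat; lra.
  - apply Kn_odd in En; [|assumption]. set (k := Kn n) in *.
    pose proof (odd_last_angle n k En) as HM. rewrite HM, sin_shift in Hs.
    assert (0 < cos (PI / INR n / 2)) by (apply cos_gt_0; lra).
    apply (chord_cdf_one n r k); try assumption; [nra|]. intros x Hx.
    apply all_chords_le_odd; try assumption. rewrite (A1_odd n r k En), HM.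
    replace (PI / 2 - PI / INR n / 2 + x) with (PI / 2 + (x - PI / INR n / 2)) by ring.
    rewrite sin_plus, sin_PI2, cos_PI2.
    assert (cos (PI / INR n / 2) <= cos (x - PI / INR n / 2)).
    { destruct (Rle_dec 0 (x - PI / INR n / 2)); [apply cos_decr_1; lra|].
      rewrite <- (cos_neg (x - _)). apply cos_decr_1; lra. }
    rewrite Rmult_1_l, Rmult_0_l, Rplus_0_r.
    replace (2 * r * cos (PI / INR n / 2) ^ 2)
      with (2 * r * cos (PI / INR n / 2) * cos (PI / INR n / 2)) by ring.
    apply Rmult_le_compat; nra.
Qed.

(** Supplies [s' = ell n r (k + 1)] for [chord_cdf_two_pairs]. The sine must increase up to [k + 2]
    times [PI / INR n], which fails for the last [k] of odd [n]. *)
Lemma ell_sin_le_A1 (n : nat) (r : R) (k : nat) (x : R) : (2 * (k + 2) <= n)%nat -> 0 < r ->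
  0 <= x <= PI / INR n ->
  ell n r (k + 1) * sin ((INR k + 1) * (PI / INR n) + x) <= A1 n r (k + 1).
Proof.
  intros Hk Hr Hx. rewrite ellE, A1E.
  pose proof (angle_le_half n (k + 1) ltac:(lia) ltac:(lia)) as H1.
  pose proof (angle_le_half n (k + 2) ltac:(lia) ltac:(lia)) as H2.
  rewrite plus_INR in *. simpl (INR 1) in *. simpl (INR 2) in *.
  apply Rmult_le_compat_l.
  - assert (0 <= sin ((INR k + 1) * (PI / INR n))) by (apply sin_ge_0; lra). nra.
  - apply sin_incr_1; lra.
Qed.

(* The only [k] whose range of [s] reaches [lam n r] is [Kn n]. *)
Lemma ell_le_lam (n : nat) (r : R) (k : nat) : n = (2 * (k + 1) + 1)%nat -> 0 < r ->
  ell n r k <= lam n r.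
Proof.
  intros En Hr. rewrite lam_half, ellE by lia.
  pose proof (angle_lt_half n 1 ltac:(lia) ltac:(lia)) as Ha. simpl (INR 1) in Ha.
  replace (INR k * (PI / INR n)) with (PI / 2 - (PI / INR n + PI / INR n / 2))
    by (pose proof (odd_last_angle n k En); lra).
  rewrite sin_shift.
  assert (PI / INR n <= PI / 3).
  { apply Rmult_le_compat_l; [lra|]. apply Rinv_le_contravar; [lra|].
    replace 3 with (INR 3) by (simpl; ring). apply le_INR. lia. }
  assert (C : cos (PI / INR n + PI / INR n / 2) <= cos (2 * (PI / INR n / 2)))
    by (apply cos_decr_1; lra).
  rewrite cos_2a_cos in C. pose proof (COS_bound (PI / INR n / 2)).
  assert (cos (PI / INR n / 2) ^ 2 <= 1) by nra. nra.
Qed.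

Theorem theorem1 (n : nat) (r : R) (hn : (3 <= n)%nat) (hr : 0 < r) :
  (forall s, s <= 0 -> chord_cdf n r s 0) /\
  (forall s, ell n r (Kn n + 1) <= s -> chord_cdf n r s 1) /\
  (forall (k : nat) (s : R), (k <= Kn n)%nat ->
     ell n r k <= s < ell n r (k + 1) -> 0 < s ->
     chord_cdf n r s (Hk n r k s)).
Proof.
  split; [intros s; apply chord_cdf_nonpos; assumption|].
  split; [intros s; apply chord_cdf_full; assumption|].
  intros k s hk_le Hell Hs. unfold Hk. cbv zeta.
  assert (Hgen : (2 * (k + 2) <= n)%nat ->
    chord_cdf n r s (1 - hk n r k s (A1 n r k) (B1 n k)
                     + hk n r (k + 1) s (A1 n r k) (B1 n k + PI / INR n))).
  { intros Hkn. apply chord_cdf_two_pairs; try assumption; try lia; try lra.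
    exists (ell n r (k + 1)). split; [lra|]. intros x. apply ell_sin_le_A1; assumption. }
  destruct (Nat.even n) eqn:En.
  - pose proof (Kn_even n hn En) as EK. destruct (Nat.ltb_spec k (Kn n)) as [C|C].
    + apply Hgen; lia.
    + replace k with (Kn n) in * by lia. apply chord_cdf_even_last; try assumption; lra.
  - pose proof (Kn_odd n hn En) as EK. destruct Rlt_dec as [C|C].
    + destruct (Nat.eq_dec k (Kn n)) as [->|C']; [|apply Hgen; lia].
      apply chord_cdf_two_pairs; try assumption; try lia; try lra.
      (* Here [A1 n r (Kn n + 1)] is [lam n r] itself, so the endpoint condition only says that a
         sine is at most [1]. *)
      exists (lam n r). split; [assumption|]. intros x Hx.
      rewrite (A1_odd n r (Kn n) EK), <- lam_half by lia.
      pose proof (SIN_bound ((INR (Kn n) + 1) * (PI / INR n) + x)). nra.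
    + destruct (Nat.eq_dec k (Kn n)) as [->|C'].
      * apply chord_cdf_odd_last; try assumption; lra.
      * exfalso. apply C. apply Rlt_le_trans with (ell n r (k + 1)); [lra|].
        apply Rle_trans with (ell n r (Kn n)); [apply ell_mono; lia || lra|].
        apply ell_le_lam; assumption.
Qed.
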